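(* Let $\bar A_q^\triangleright$ be the subalgebra of $U_q(\widehat{sl_2})$ generated by $\{W^\triangleright_{-k},W^\triangleright_{k+1},G^\triangleright_{k+1},\tilde G^\triangleright_{k+1}\mid k\in\mathbb N\}$, let $\bar A_q^\triangleleft$ be the subalgebra generated by $\{W^\triangleleft_{-k},W^\triangleleft_{k+1},G^\triangleleft_{k+1},\tilde G^\triangleleft_{k+1}\mid k\in\mathbb N\}$, and let $U_q^{DJ,0}$ be the subalgebra generated by $K_0^{\pm1},K_1^{\pm1}$. Then there is the tensor product decomposition (as vector spaces, via multiplication) $$U_q(\widehat{sl_2})\cong\bar A_q^\triangleright\otimes U_q^{DJ,0}\otimes\bar A_q^\triangleleft.$$
   Context: $\mathbb N=\{0,1,2,\dots\}$. Base field $\mathbb C(q)$; $[X,Y]=XY-YX$, $[X,Y]_{q^{\pm1}}=q^{\pm1}XY-q^{\mp1}YX$. $U_q(\widehat{sl_2})$ (Drinfeld–Jimbo presentation, no derivation) has generators $E_j,F_j,K_j^{\pm1}$, $j\in\{0,1\}$, and relations, with $a_{ii}=2$, $a_{ij}=-2$ for $i\ne j$: $K_iK_j=K_jK_i$, $K_iK_i^{-1}=K_i^{-1}K_i=1$, $K_iE_jK_i^{-1}=q^{a_{ij}}E_j$, $K_iF_jK_i^{-1}=q^{-a_{ij}}F_j$, $[E_i,F_j]=\delta_{ij}\frac{K_i-K_i^{-1}}{q-q^{-1}}$, and for $i\neq j$ $[E_i,[E_i,[E_i,E_j]_q]_{q^{-1}}]=0=[F_i,[F_i,[F_i,F_j]_q]_{q^{-1}}]$.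 Root vectors: $E_{\alpha_0}=E_0$, $E_{\alpha_1}=E_1$, $E_\delta=E_0E_1-q^{-2}E_1E_0$; for $k\in\mathbb N$, $E_{(k+1)\delta+\alpha_1}=\frac{[E_\delta,E_{k\delta+\alpha_1}]}{q+q^{-1}}$, $E_{(k+1)\delta+\alpha_0}=\frac{[E_{k\delta+\alpha_0},E_\delta]}{q+q^{-1}}$; and the mutually commuting $E_{n\delta}$ ($n\ge1$) are defined by $\exp\big((q-q^{-1})\sum_{k\ge1}E_{k\delta}z^k\big)=1+(q-q^{-1})\sum_{k\ge1}\tilde\psi_kz^k$ with $\tilde\psi_k=E_{(k-1)\delta+\alpha_0}E_{\alpha_1}-q^{-2}E_{\alpha_1}E_{(k-1)\delta+\alpha_0}$. Right alternating generators: with $U=qu^2/(q+q^{-1})$, $\mathcal X(u)=\exp\big(-(q-q^{-1})\sum_{n\ge1}\frac{1}{q^n+q^{-n}}E_{n\delta}(qu^2)^{-n}\big)$ and $\bar\rho=-q(q+q^{-1})^2$, they are defined by $$\sum_{k\ge0}W^\triangleright_{-k}U^{-k-1}=(q+q^{-1})\mathcal X(u)\sum_{k\ge0}q^kE_{k\delta+\alpha_1}(qu^2)^{-k-1},$$ $$\sum_{k\ge0}W^\triangleright_{k+1}U^{-k-1}=(q+q^{-1})\Big(\sum_{k\ge0}q^{k}E_{k\delta+\alpha_0}(qu^2)^{-k-1}\Big)\mathcal X(u),\qquad \sum_{k\ge0}G^\triangleright_{k+1}U^{-k-1}=\frac{\bar\rho}{q-q^{-1}}(\mathcal X(u)-1),$$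 and $\tilde G^\triangleright_{k+1}=G^\triangleright_{k+1}+(q+q^{-1})[W^\triangleright_0,W^\triangleright_{k+1}]$. In particular $W_0^\triangleright=E_1$, $W_1^\triangleright=E_0$. Left alternating generators: the images of the corresponding right alternating generators under $\Omega$, the $\mathbb C$-linear ring antiautomorphism of $U_q(\widehat{sl_2})$ with $\Omega(E_i)=F_i$, $\Omega(F_i)=E_i$, $\Omega(K_i)=K_i^{-1}$ ($i=0,1$), $\Omega(q)=q^{-1}$. In particular $W_0^\triangleleft=F_1$, $W_1^\triangleleft=F_0$. *)

(* Defs.v *)
From HB Require Import structures.
From mathcomp Require Import all_boot all_order all_algebra.
From mathcomp Require Import boolp reals.
From mathcomp Require Import finmap complex monalg.

Set Implicit Arguments.
Unset Strict Implicit.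
Unset Printing Implicit Defensive.

Import GRing.Theory.
Local Open Scope ring_scope.
Local Open Scope quotient_scope.

Section Span.
Variables (K : pzRingType) (M : lmodType K) (S : M -> Prop).

Definition span : {pred M} := fun x =>
  `[< forall P : {pred M}, submod_closed P -> (forall y, S y -> y \in P) ->
      x \in P >].

Lemma spanP x : reflect (forall P : {pred M}, submod_closed P ->
  (forall y, S y -> y \in P) -> x \in P) (x \in span).
Proof. exact: asboolP. Qed.

Lemma mem_span x : S x -> x \in span.
Proof. by move=> Sx; apply/spanP => P _; apply. Qed.

Lemma span_ind (P : M -> Prop) : P 0 ->
  (forall a x y, P x -> P y -> P (a *: x + y)) -> (forall x, S x -> P x) ->
  forall x, x \in span -> P x.
Proof.
move=> P0 Plin SP x /spanP/(_ (fun x => `[< P x >])) Px.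
apply/asboolP/Px => [|y Sy]; last exact/asboolP/SP.
by split=> [|a y z /asboolP Py /asboolP Pz]; apply/asboolP; last exact: Plin.
Qed.

Lemma span_submod_closed : submod_closed span.
Proof.
split=> [|a x y /spanP xP /spanP yP]; apply/spanP=> P PP SP.
  by case: PP.
by case: (PP) => _; apply; [apply: xP | apply: yP].
Qed.

HB.instance Definition _ := GRing.isSubmodClosed.Build K M span
  (GRing.submod_closed_semi span_submod_closed).

Lemma span0 : 0 \in span. Proof. exact: rpred0. Qed.
Lemma spanD x y : x \in span -> y \in span -> x + y \in span.
Proof. exact: rpredD. Qed.
Lemma spanZ a x : x \in span -> a *: x \in span.
Proof. exact: rpredZ. Qed.

Definition eqmod (x y : M) := x - y \in span.

Lemma eqmod_refl : reflexive eqmod.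
Proof. by move=> x; rewrite /eqmod subrr rpred0. Qed.
Lemma eqmod_sym : symmetric eqmod.
Proof. by move=> x y; rewrite /eqmod -opprB rpredN. Qed.
Lemma eqmod_trans : transitive eqmod.
Proof.
by move=> y x z xy yz; rewrite /eqmod -(subrK y x) -addrA rpredD.
Qed.

Definition eqmod_equiv := EquivRel eqmod eqmod_refl eqmod_sym eqmod_trans.

(* The quotient of the module M by its submodule spanned by S. *)
Definition quotmod := {eq_quot eqmod_equiv}.

HB.instance Definition _ := EqQuotient.on quotmod.
HB.instance Definition _ := Choice.on quotmod.

Definition quotmod_pi : M -> quotmod := \pi_quotmod.

Lemma quotmod_piE x y : (quotmod_pi x = quotmod_pi y) <-> (x - y \in span).
Proof. by split=> [/eqquotP|h]; [|apply/eqquotP]. Qed.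

Lemma quotmod_reprK (x : quotmod) : quotmod_pi (repr x) = x.
Proof. exact: reprK. Qed.

Lemma quotmod_repr x : x - repr (quotmod_pi x) \in span.
Proof. by apply/quotmod_piE; rewrite quotmod_reprK. Qed.

Lemma quotmod_reprN x : repr (quotmod_pi x) - x \in span.
Proof. by rewrite -opprB rpredN quotmod_repr. Qed.

Definition quotmod_add (x y : quotmod) := quotmod_pi (repr x + repr y).
Definition quotmod_opp (x : quotmod) := quotmod_pi (- repr x).
Definition quotmod_scale a (x : quotmod) := quotmod_pi (a *: repr x).

Let pi_add x y :
  quotmod_add (quotmod_pi x) (quotmod_pi y) = quotmod_pi (x + y).
Proof.
by apply/quotmod_piE; rewrite opprD addrACA rpredD ?quotmod_reprN.
Qed.
Let pi_opp x : quotmod_opp (quotmod_pi x) = quotmod_pi (- x).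
Proof. by apply/quotmod_piE; rewrite -opprD rpredN quotmod_reprN. Qed.
Let pi_scale a x : quotmod_scale a (quotmod_pi x) = quotmod_pi (a *: x).
Proof. by apply/quotmod_piE; rewrite -scalerBr rpredZ ?quotmod_reprN. Qed.

Lemma quotmod_ind (P : quotmod -> Prop) :
  (forall x, P (quotmod_pi x)) -> forall x, P x.
Proof. by move=> h x; rewrite -(quotmod_reprK x). Qed.

Let addA : associative quotmod_add.
Proof.
elim/quotmod_ind=> x; elim/quotmod_ind=> y; elim/quotmod_ind=> z.
by rewrite !pi_add addrA.
Qed.
Let addC : commutative quotmod_add.
Proof.
by elim/quotmod_ind=> x; elim/quotmod_ind=> y; rewrite !pi_add addrC.
Qed.
Let add0 : left_id (quotmod_pi 0) quotmod_add.
Proof. by elim/quotmod_ind=> x; rewrite pi_add add0r. Qed.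
Let addN : left_inverse (quotmod_pi 0) quotmod_opp quotmod_add.
Proof. by elim/quotmod_ind=> x; rewrite pi_opp pi_add addNr. Qed.

HB.instance Definition _ := GRing.isZmodule.Build quotmod addA addC add0 addN.

Let scaleA a b v :
  quotmod_scale a (quotmod_scale b v) = quotmod_scale (a * b) v.
Proof. by elim/quotmod_ind: v => v; rewrite !pi_scale scalerA. Qed.
Let scale1 : left_id 1 quotmod_scale.
Proof. by elim/quotmod_ind=> v; rewrite pi_scale scale1r. Qed.
Let scaleDr : right_distributive quotmod_scale +%R.
Proof.
move=> a; elim/quotmod_ind=> v; elim/quotmod_ind=> w.
by rewrite -[_ + _]/(quotmod_add _ _) pi_add !pi_scale scalerDr -pi_add.
Qed.
Let scaleDl v : {morph quotmod_scale^~ v : a b / a + b}.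
Proof.
by move=> a b; elim/quotmod_ind: v => v; rewrite !pi_scale scalerDl -pi_add.
Qed.

HB.instance Definition _ :=
  GRing.Zmodule_isLmodule.Build K quotmod scaleA scale1 scaleDr scaleDl.

Lemma quotmod_pi_linear : linear quotmod_pi.
Proof. by move=> a x y; rewrite -pi_add -pi_scale. Qed.

HB.instance Definition _ :=
  GRing.isLinear.Build K M quotmod *:%R quotmod_pi quotmod_pi_linear.

Lemma quotmod_pi_eq0 x : S x -> quotmod_pi x = 0.
Proof.
by move=> Sx; apply/quotmod_piE; rewrite subr0; apply: mem_span.
Qed.

End Span.

Arguments quotmod_pi {K M} S.

Section QuotientAlgebra.
Variables (K : fieldType) (A : algType K) (rel : A -> A -> Prop).

(* The linear span of these elements is the two-sided ideal generated by the
   relators l - r. *)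
Definition ideal_gen (x : A) : Prop :=
  exists a b l r, rel l r /\ x = a * (l - r) * b.

(* A modulo the relations l = r for all l, r such that rel l r. It may be the
   zero ring. *)
Definition quotalg := quotmod ideal_gen.

HB.instance Definition _ := GRing.Lmodule.on quotalg.

Definition quotalg_pi : A -> quotalg := quotmod_pi ideal_gen.
HB.instance Definition _ := GRing.Linear.on quotalg_pi.

Lemma quotalg_ind (P : quotalg -> Prop) :
  (forall x, P (quotalg_pi x)) -> forall x, P x.
Proof. exact: quotmod_ind. Qed.

Lemma quotalg_piE x y :
  (quotalg_pi x = quotalg_pi y) <-> (x - y \in span ideal_gen).
Proof. exact: quotmod_piE. Qed.

Lemma quotalg_rel l r : rel l r -> quotalg_pi l = quotalg_pi r.
Proof.
move=> lr; apply/quotalg_piE/mem_span.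
by exists 1, 1, l, r; rewrite mul1r mulr1.
Qed.

Lemma ideal_mull a x : x \in span ideal_gen -> a * x \in span ideal_gen.
Proof.
move: x; apply: (span_ind (P := fun x => a * x \in span ideal_gen)).
- by rewrite mulr0 span0.
- by move=> c u v au av; rewrite mulrDr -scalerAr spanD // spanZ.
- move=> _ [b [c [l [r [lr ->]]]]]; apply: mem_span.
  by exists (a * b), c, l, r; rewrite !mulrA.
Qed.

Lemma ideal_mulr a x : x \in span ideal_gen -> x * a \in span ideal_gen.
Proof.
move: x; apply: (span_ind (P := fun x => x * a \in span ideal_gen)).
- by rewrite mul0r span0.
- by move=> c u v au av; rewrite mulrDl -scalerAl spanD // spanZ.
- move=> _ [b [c [l [r [lr ->]]]]]; apply: mem_span.
  by exists b, (c * a), l, r; rewrite !mulrA.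
Qed.

Definition quotalg_mul (x y : quotalg) : quotalg :=
  quotalg_pi (repr x * repr y).

Let pi_mul x y :
  quotalg_mul (quotalg_pi x) (quotalg_pi y) = quotalg_pi (x * y).
Proof.
apply/quotalg_piE; set u := repr _; set v := repr _.
rewrite -(subrK (u * y) (u * v)) -addrA -mulrBr -mulrBl.
by apply: spanD; [apply: ideal_mull | apply: ideal_mulr];
  apply: quotmod_reprN.
Qed.

Let mulA : associative quotalg_mul.
Proof.
elim/quotalg_ind=> x; elim/quotalg_ind=> y; elim/quotalg_ind=> z.
by rewrite !pi_mul mulrA.
Qed.
Let mul1 : left_id (quotalg_pi 1) quotalg_mul.
Proof. by elim/quotalg_ind=> x; rewrite pi_mul mul1r. Qed.
Let mulr1' : right_id (quotalg_pi 1) quotalg_mul.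
Proof. by elim/quotalg_ind=> x; rewrite pi_mul mulr1. Qed.
Let mulDl : left_distributive quotalg_mul +%R.
Proof.
elim/quotalg_ind=> x; elim/quotalg_ind=> y; elim/quotalg_ind=> z.
by rewrite -linearD !pi_mul -linearD mulrDl.
Qed.
Let mulDr : right_distributive quotalg_mul +%R.
Proof.
elim/quotalg_ind=> x; elim/quotalg_ind=> y; elim/quotalg_ind=> z.
by rewrite -linearD !pi_mul -linearD mulrDr.
Qed.

HB.instance Definition _ := GRing.Zmodule_isPzRing.Build quotalg
  mulA mul1 mulr1' mulDl mulDr.

Lemma quotalg_piZ : scalable quotalg_pi.
Proof. by move=> a x; rewrite linearZ. Qed.

Lemma quotalg_piM : {morph quotalg_pi : x y / x * y}.
Proof. by move=> x y; rewrite -pi_mul. Qed.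

HB.instance Definition _ :=
  GRing.isMonoidMorphism.Build A quotalg quotalg_pi
    (conj (erefl _) quotalg_piM).

Lemma quotalg_scaleAl a (x y : quotalg) : a *: (x * y) = (a *: x) * y.
Proof.
elim/quotalg_ind: x => x; elim/quotalg_ind: y => y.
by rewrite -quotalg_piM -!linearZ -quotalg_piM /= scalerAl.
Qed.
Lemma quotalg_scaleAr a (x y : quotalg) : a *: (x * y) = x * (a *: y).
Proof.
elim/quotalg_ind: x => x; elim/quotalg_ind: y => y.
by rewrite -quotalg_piM -!linearZ -quotalg_piM /= scalerAr.
Qed.

Section Kernel.
Variables (B : nzRingType) (f : A -> B).
Hypotheses (fB : {morph f : x y / x - y})
  (fZ : forall a x, f x = 0 -> f (a *: x) = 0)
  (frel : forall l r, rel l r -> f l = f r).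

Let quotalg_kernel_aux : (forall x y z, f y = 0 -> f (x * y * z) = 0) ->
  forall x y, quotalg_pi x = quotalg_pi y -> f x = f y.
Proof.
have f0 : f 0 = 0 by rewrite -(subrr 0) fB subrr.
have fD x y : f (x + y) = f x + f y.
  by rewrite -{1}[y]opprK -[- y]sub0r !fB f0 sub0r opprK.
move=> fM x y /quotalg_piE xy; apply/eqP; rewrite -subr_eq0 -fB; apply/eqP.
move: (x - y) xy; apply: (span_ind (P := fun x => f x = 0)) => //.
- by move=> a u v u0 v0; rewrite fD v0 addr0 fZ.
- move=> _ [b [c [l [r [lr ->]]]]].
  by apply: fM; rewrite fB (frel lr) subrr.
Qed.

Lemma quotalg_kernel : {morph f : x y / x * y} ->
  forall x y, quotalg_pi x = quotalg_pi y -> f x = f y.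
Proof.
by move=> fM; apply: quotalg_kernel_aux => x y z y0; rewrite !fM y0 mulr0 mul0r.
Qed.

Lemma quotalg_antikernel : (forall x y, f (x * y) = f y * f x) ->
  forall x y, quotalg_pi x = quotalg_pi y -> f x = f y.
Proof.
by move=> fM; apply: quotalg_kernel_aux => x y z y0; rewrite !fM y0 mul0r mulr0.
Qed.

End Kernel.

End QuotientAlgebra.

Arguments quotalg_pi {K A} rel.

Section Tensor.
Variables (K : fieldType) (V W : lmodType K).

Local Notation "<| v , w |>" := (<< (v, w) >> : {malg K[(V * W)%type]}).

Inductive tensor_rel : {malg K[(V * W)%type]} -> Prop :=
| tensor_relDl v v' w :
    tensor_rel (<| v + v', w |> - <| v, w |> - <| v', w |>)
| tensor_relDr v w w' :
    tensor_rel (<| v, w + w' |> - <| v, w |> - <| v, w' |>)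
| tensor_relZl a v w : tensor_rel (<| a *: v, w |> - a *: <| v, w |>)
| tensor_relZr a v w : tensor_rel (<| v, a *: w |> - a *: <| v, w |>).

(* The tensor product over K: the free module on V * W modulo bilinearity. *)
Definition tensor := quotmod tensor_rel.

HB.instance Definition _ := GRing.Lmodule.on tensor.

Definition pure_tensor (v : V) (w : W) : tensor :=
  quotmod_pi tensor_rel <| v, w |>.

Lemma pure_tensorDl v v' w :
  pure_tensor (v + v') w = pure_tensor v w + pure_tensor v' w.
Proof.
have := quotmod_pi_eq0 (tensor_relDl v v' w); rewrite !linearB /=.
by move/eqP; rewrite -addrA -opprD subr_eq0 => /eqP.
Qed.

Lemma pure_tensorDr v w w' :
  pure_tensor v (w + w') = pure_tensor v w + pure_tensor v w'.
Proof.
have := quotmod_pi_eq0 (tensor_relDr v w w'); rewrite !linearB /=.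
by move/eqP; rewrite -addrA -opprD subr_eq0 => /eqP.
Qed.

Lemma pure_tensorZl a v w : pure_tensor (a *: v) w = a *: pure_tensor v w.
Proof.
have := quotmod_pi_eq0 (tensor_relZl a v w); rewrite linearB linearZ /=.
by move/eqP; rewrite subr_eq0 => /eqP.
Qed.

Lemma pure_tensorZr a v w : pure_tensor v (a *: w) = a *: pure_tensor v w.
Proof.
have := quotmod_pi_eq0 (tensor_relZr a v w); rewrite linearB linearZ /=.
by move/eqP; rewrite subr_eq0 => /eqP.
Qed.

Lemma tensor_span (t : tensor) : exists s : seq (K * (V * W)),
  t = \sum_(x <- s) x.1 *: pure_tensor x.2.1 x.2.2.
Proof.
elim/quotmod_ind: t => x; rewrite [x]monalgE linear_sum.
exists [seq (x@_k, k) | k <- msupp x]; rewrite big_map; apply: eq_bigr => k _.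
case: k => v w /=; rewrite -linearZ /=; congr quotmod_pi.
by apply/malgP => k; rewrite mcoeffZ !mcoeffU mulr_natr.
Qed.

Lemma tensor_lift (X : lmodType K) (f : V -> W -> X) :
    (forall w, linear (f^~ w)) -> (forall v, linear (f v)) ->
  exists2 phi : {linear tensor -> X},
    (forall v w, phi (pure_tensor v w) = f v w) &
    forall phi' : {linear tensor -> X},
      (forall v w, phi' (pure_tensor v w) = f v w) -> phi' =1 phi.
Proof.
move=> fl fr; pose e (x : {malg K[(V * W)%type]}) :=
  \sum_(k <- msupp x) x@_k *: f k.1 k.2.
have eEw (d : {fset V * W}) x : (msupp x `<=` d)%fset ->
    e x = \sum_(k <- d) x@_k *: f k.1 k.2.
  move=> xd; rewrite /e (big_fset_incl _ xd) // => k _ /mcoeff_outdom ->.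
  by rewrite scale0r.
have elin : linear e.
  move=> a x y; pose d := (msupp x `|` msupp y `|` msupp (a *: x + y))%fset.
  have dx : (msupp x `<=` d)%fset by rewrite /d -fsetUA fsubsetUl.
  have dy : (msupp y `<=` d)%fset by rewrite /d fsubsetU // fsubsetUr.
  rewrite (eEw _ _ dx) (eEw _ _ dy) (eEw d) ?fsubsetUr //.
  rewrite scaler_sumr -big_split /=.
  by apply: eq_bigr => k _; rewrite mcoeffD mcoeffZ scalerDl scalerA.
pose fe := GRing.isLinear.Build _ _ _ _ e elin.
pose E : {linear {malg K[(V * W)%type]} -> X} := HB.pack e fe.
have eU v w : e <| v, w |> = f v w.
  rewrite (@eEw [fset (v, w)]%fset) ?msuppU_le //.
  by rewrite big_seq_fset1 mcoeffUU scale1r.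
have fl0 w : f 0 w = 0.
  by have := fl w (-1) 0 0; rewrite scaler0 addr0 scaleN1r addNr.
have fr0 v : f v 0 = 0.
  by have := fr v (-1) 0 0; rewrite scaler0 addr0 scaleN1r addNr.
have fZl a v w : f (a *: v) w = a *: f v w.
  by have := fl w a v 0; rewrite addr0 fl0 addr0.
have fZr a v w : f v (a *: w) = a *: f v w.
  by have := fr v a w 0; rewrite addr0 fr0 addr0.
have eB x y : e (x - y) = e x - e y := raddfB E x y.
have eZ a x : e (a *: x) = a *: e x := linearZ_LR E a x.
have e0 x y : quotmod_pi tensor_rel x = quotmod_pi tensor_rel y -> e x = e y.
  move/quotmod_piE => xy; apply/eqP; rewrite -subr_eq0 -eB; apply/eqP.
  move: (x - y) xy; apply: (span_ind (P := fun x => e x = 0)).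
  - exact: (raddf0 E).
  - by move=> a u v u0 v0; rewrite elin u0 v0 scaler0 addr0.
  move=> _ [v v' w|v w w'|a v w|a v w].
  - rewrite !eB !eU; have := fl w 1 v v'; rewrite !scale1r => ->.
    by rewrite addrAC addrK subrr.
  - rewrite !eB !eU; have := fr v 1 w w'; rewrite !scale1r => ->.
    by rewrite addrAC addrK subrr.
  - by rewrite eB eZ !eU fZl subrr.
  - by rewrite eB eZ !eU fZr subrr.
pose p (t : tensor) := e (repr t).
have ppi x : p (quotmod_pi tensor_rel x) = e x.
  by apply: e0; apply: quotmod_reprK.
have plin : linear p.
  move=> a; elim/quotmod_ind=> x; elim/quotmod_ind=> y.
  by rewrite -linearP !ppi elin.
pose fp := GRing.isLinear.Build _ _ _ _ p plin.
pose P : {linear tensor -> X} := HB.pack p fp.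
have PE v w : P (pure_tensor v w) = f v w by rewrite /= ppi eU.
exists P => // phi' phi'E t; have [s ->] := tensor_span t.
rewrite !linear_sum; apply: eq_bigr => x _.
by rewrite !linearZ phi'E PE.
Qed.

End Tensor.

Section Subalgebra.
Variables (K : fieldType) (A : algType K) (S : A -> Prop).

Definition subalg : {pred A} := fun x =>
  `[< forall P : {pred A}, GRing.subalg_closed P ->
      (forall y, S y -> y \in P) -> x \in P >].

Lemma subalgP x : reflect (forall P : {pred A}, GRing.subalg_closed P ->
  (forall y, S y -> y \in P) -> x \in P) (x \in subalg).
Proof. exact: asboolP. Qed.

Lemma mem_subalg x : S x -> x \in subalg.
Proof. by move=> Sx; apply/subalgP => P _; apply. Qed.

Lemma subalg_subalg_closed : GRing.subalg_closed subalg.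
Proof.
split=> [|a x y /subalgP xP /subalgP yP|x y /subalgP xP /subalgP yP];
  apply/subalgP=> P PP SP; case: (PP) => P1 Plin Pmul //.
- by apply: Plin; [apply: xP | apply: yP].
- by apply: Pmul; [apply: xP | apply: yP].
Qed.

HB.instance Definition _ := GRing.isSubalgClosed.Build K A subalg
  (GRing.subalg_closed_semi subalg_subalg_closed).

(* The subalgebra of A generated by S, as an algebra in its own right. *)
Definition subalg_of := {x : A | x \in subalg}.

HB.instance Definition _ := SubType.on subalg_of.
HB.instance Definition _ := Choice.on subalg_of.
HB.instance Definition _ := [SubChoice_isSubAlgebra of subalg_of by <:].

End Subalgebra.

Section Series.
Variables (K : fieldType) (A : algType K).

(* Formal power series over A in one central variable, as sequences of
   coefficients. *)
Definition series := nat -> A.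

Definition series1 : series := fun n => (n == 0%N)%:R.
Definition seriesM (f g : series) : series :=
  fun n => \sum_(i < n.+1) f i * g (n - i)%N.
Definition seriesX (f : series) (m : nat) : series :=
  iter m (seriesM f) series1.
Arguments seriesX : simpl never.

(* exp f; meaningful in characteristic 0 and when f 0 = 0, so that f ^ m has no
   coefficient below m and the sum over m stops at n. *)
Definition series_exp (f : series) : series :=
  fun n => \sum_(m < n.+1) ((m`!)%:R : K)^-1 *: seriesX f m n.

(* The inverse of series_exp on the series with constant term 1: the n-th
   coefficient of exp f is f n plus a function of the f i with i < n. *)
Fixpoint series_log_upto (g : series) (n : nat) : series :=
  if n is n'.+1 then
    fun i => if i == n' then g n' - series_exp (series_log_upto g n') n'
             else series_log_upto g n' i
  else fun=> 0.
Definition series_log (g : series) : series :=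
  fun n => series_log_upto g n.+1 n.

Lemma seriesXS f m n :
  seriesX f m.+1 n = \sum_(i < n.+1) f i * seriesX f m (n - i)%N.
Proof. by []. Qed.

Lemma seriesX_eq f g m n : (forall i, (i <= n)%N -> f i = g i) ->
  forall k, (k <= n)%N -> seriesX f m k = seriesX g m k.
Proof.
move=> fg; elim: m => [|m IHm] k kn //; rewrite !seriesXS; apply: eq_bigr => i _.
rewrite fg ?IHm //; first by rewrite (leq_trans _ kn) ?leq_subr.
by rewrite (leq_trans _ kn) // -ltnS ltn_ord.
Qed.

Lemma seriesX_lt f m n : f 0%N = 0 -> (n < m)%N -> seriesX f m n = 0.
Proof.
move=> f0; elim: m n => [|m IHm] n // nm; rewrite seriesXS big_ord_recl.
rewrite f0 mul0r add0r big1 // => i _; rewrite IHm ?mulr0 //=.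
by rewrite /bump /= add1n; case: n nm i => [|n] nm [i ?] //=;
  rewrite subSS (leq_ltn_trans (leq_subr _ _)).
Qed.

Lemma seriesX_top f g m n : f 0%N = 0 -> g 0%N = 0 ->
  (forall i, (i < n)%N -> f i = g i) ->
  m != 1%N -> seriesX f m n = seriesX g m n.
Proof.
move=> f0 g0 fg; case: m => [|[|m]] // _; rewrite 2!(seriesXS _ m.+1).
apply: eq_bigr => i _; have := ltn_ord i; move: (i : nat) => {}i.
rewrite ltnS leq_eqVlt.
case/orP=> [/eqP->|lt_i].
  by rewrite subnn !(@seriesX_lt _ m.+1) ?mulr0.
rewrite fg //.
case: i lt_i => [|i] lt_i; first by rewrite g0 !mul0r.
congr (_ * _); apply: (@seriesX_eq _ _ _ n.-1) => [j jn|].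
  by apply: fg; rewrite (leq_ltn_trans jn) // ltn_predL (leq_trans _ lt_i).
by case: n lt_i {fg} => // n; rewrite subSS leq_subr.
Qed.

Lemma seriesX1 f n : seriesX f 1 n = f n.
Proof.
rewrite /seriesX /= /seriesM big_ord_recr /= subnn mulr1 big1 ?add0r // => i _.
by rewrite /series1 subn_eq0 leqNgt ltn_ord /= mulr0.
Qed.

Lemma series_exp_top f g n : f 0%N = 0 -> g 0%N = 0 -> (0 < n)%N ->
  (forall i, (i < n)%N -> f i = g i) ->
  series_exp f n - f n = series_exp g n - g n.
Proof.
case: n => // n f0 g0 _ fg; rewrite /series_exp.
pose i1 := Ordinal (isT : 1 < n.+2)%N.
rewrite (bigD1 i1) //= [X in _ = X - _](bigD1 i1) //=.
rewrite !seriesX1 invr1 !scale1r ![_ + _ - _]addrAC !subrr !add0r.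
apply: eq_bigr => i ne_i1.
by congr (_ *: _); apply: seriesX_top.
Qed.

Lemma series_exp0 f : series_exp f 0%N = 1.
Proof. by rewrite /series_exp big_ord1 /= invr1 scale1r. Qed.

Lemma series_logE g n :
  series_log g n = g n - series_exp (series_log_upto g n) n.
Proof. by rewrite /series_log /= eqxx. Qed.

Lemma series_log0 g : g 0%N = 1 -> series_log g 0%N = 0.
Proof. by move=> g0; rewrite /series_log /= series_exp0 g0 subrr. Qed.

Lemma series_log_uptoE g n i : 
  series_log_upto g n i = if (i < n)%N then series_log g i else 0.
Proof.
elim: n i => [|n IHn] i //=; case: eqVneq => [->|ni].
  by rewrite ltnSn series_logE.
by rewrite IHn ltnS [in RHS]leq_eqVlt (negPf ni).
Qed.

Lemma series_logK g : g 0%N = 1 ->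
  forall n, series_exp (series_log g) n = g n.
Proof.
move=> g0 [|n]; first by rewrite series_exp0.
pose f := series_log_upto g n.+1.
have f0 : f 0%N = 0 by rewrite /f series_log_uptoE series_log0.
have ff i : (i < n.+1)%N -> series_log g i = f i.
  by rewrite /f series_log_uptoE => ->.
have := series_exp_top (series_log0 g0) f0 (isT : 0 < n.+1)%N ff.
rewrite [X in _ - X = _]series_logE -/f.
have -> : f n.+1 = 0 by rewrite /f series_log_uptoE ltnn.
by rewrite subr0 opprB addrA addrAC -[RHS]add0r => /addIr/eqP;
  rewrite subr_eq0 => /eqP.
Qed.

Lemma series_log_unique f g : f 0%N = 0 -> g 0%N = 1 ->
  (forall n, series_exp f n = g n) -> forall n, f n = series_log g n.
Proof.
move=> f0 g0 fg; elim/ltn_ind => -[|n] IHn; first by rewrite f0 series_log0.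
have := series_exp_top f0 (series_log0 g0) (isT : 0 < n.+1)%N IHn.
by rewrite series_logK // fg => /addrI/oppr_inj.
Qed.

End Series.

Definition comm (A : nzRingType) (x y : A) : A := x * y - y * x.
Definition qcomm (K : fieldType) (A : lalgType K) (c : K) (x y : A) : A :=
  c *: (x * y) - c^-1 *: (y * x).

Lemma malg_scalerAr (K : fieldType) (M : monomType) (a : K)
  (x y : {malg K[M]}) : a *: (x * y) = x * (a *: y).
Proof.
rewrite (malgMEw (fsubset_refl _) (fsubset_refl _) : x * y = _).
rewrite (malgMEw (fsubset_refl _) (msuppZ_le a y) : x * (a *: y) = _).
rewrite scaler_sumr; apply: eq_bigr => v _.
rewrite scaler_sumr; apply: eq_bigr => w _.
rewrite (mcoeffZ a y w) mulrCA; move: (_ * _) (mmul _ _) => b u.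
apply/malgP => t. rewrite (mcoeffZ a _ t). rewrite 2!mcoeffU.
by rewrite mulrnAr.
Qed.

Section FreeAlgebra.
Variables (K : fieldType) (I : choiceType).

(* The free unital associative K-algebra on I. *)
Definition free_alg := {malg K[{fmonom I}]}.

HB.instance Definition _ := GRing.Lalgebra.on free_alg.

HB.instance Definition _ := GRing.Lalgebra_isAlgebra.Build K free_alg
  (@malg_scalerAr K {fmonom I}).

Definition free_gen (i : I) : free_alg := << fmu i >>.

End FreeAlgebra.

Arguments free_gen K {I} i.

Section FreeEval.
Variables (K : fieldType) (I : choiceType) (S : nzRingType).
Variables (f : {rmorphism K -> S}) (h : I -> S).

Definition word_eval (w : {fmonom I}) : S := \prod_(i <- (w : seq I)) h i.

Lemma word_eval_mmorphism : mmorphism word_eval.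
Proof.
by split=> [v w|]; rewrite /word_eval ?fmM ?big_cat // fm1 big_nil.
Qed.

HB.instance Definition _ :=
  isMultiplicative.Build {fmonom I} S word_eval word_eval_mmorphism.

(* The f-semilinear ring morphism from the free algebra on I that extends h. *)
Definition free_eval (x : free_alg K I) : S := mmap f word_eval x.

Lemma free_eval_zmod : zmod_morphism free_eval.
Proof. by move=> x y; apply: mmapB. Qed.
HB.instance Definition _ :=
  GRing.isZmodMorphism.Build (free_alg K I) S free_eval free_eval_zmod.
Lemma free_eval1 : free_eval 1 = 1.
Proof. exact: mmap1. Qed.
Lemma free_evalZ a x : free_eval (a *: x) = f a * free_eval x.
Proof. exact: mmapZ. Qed.
Lemma free_eval_gen i : free_eval (free_gen K i) = h i.
Proof.
by rewrite /free_eval /free_gen mmapU /= rmorph1 mul1r /word_eval fmuE /= big_seq1.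
Qed.
Lemma free_evalM : (forall a s, GRing.comm (f a) s) ->
  {morph free_eval : x y / x * y}.
Proof. by move=> fC; apply: (commr_mmap_is_multiplicative _).1 => *. Qed.

End FreeEval.

(* The generators E_j, F_j, K_j and K_j^-1 for j in {0, 1}. *)
Inductive gen := GenE of 'I_2 | GenF of 'I_2 | GenK of 'I_2 | GenKV of 'I_2.

Definition gen_code (g : gen) : 'I_2 * 'I_4 :=
  match g with
  | GenE j => (j, inord 0) | GenF j => (j, inord 1)
  | GenK j => (j, inord 2) | GenKV j => (j, inord 3)
  end.
Definition gen_decode (c : 'I_2 * 'I_4) : gen :=
  match val c.2 with
  | 0 => GenE c.1 | 1 => GenF c.1 | 2 => GenK c.1 | _ => GenKV c.1
  end.
Lemma gen_codeK : cancel gen_code gen_decode.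
Proof. by case=> j; rewrite /gen_decode /= inordK. Qed.

HB.instance Definition _ := Countable.copy gen (can_type gen_codeK).

(* The Cartan matrix of affine sl_2. *)
Definition cartan (i j : 'I_2) : int := if i == j then 2 else - 2.

Section Presentation.
Variables (K : fieldType) (q : K).

Section Relations.
Variables (A : algType K) (X : gen -> A).

Local Notation E j := (X (GenE j)).
Local Notation F j := (X (GenF j)).
Local Notation "'K_ j" := (X (GenK j)) (at level 8, j at level 2).
Local Notation "'KV_ j" := (X (GenKV j)) (at level 8, j at level 2).

(* The Drinfeld-Jimbo relations between the elements X g of an algebra A;
   ord0 and ord_max are the nodes 0 and 1. *)
Inductive DJ_rel : A -> A -> Prop :=
| rel_KK i j : DJ_rel ('K_i * 'K_j) ('K_j * 'K_i)
| rel_KKV i : DJ_rel ('K_i * 'KV_i) 1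
| rel_KVK i : DJ_rel ('KV_i * 'K_i) 1
| rel_KE i j : DJ_rel ('K_i * E j * 'KV_i) (q ^ cartan i j *: E j)
| rel_KF i j : DJ_rel ('K_i * F j * 'KV_i) (q ^ (- cartan i j) *: F j)
| rel_EF i j : DJ_rel (comm (E i) (F j))
    (if i == j then (q - q^-1)^-1 *: ('K_i - 'KV_i) else 0)
| rel_serreE i j of i != j :
    DJ_rel (comm (E i) (qcomm q^-1 (E i) (qcomm q (E i) (E j)))) 0
| rel_serreF i j of i != j :
    DJ_rel (comm (F i) (qcomm q^-1 (F i) (qcomm q (F i) (F j)))) 0.

(* The counit E_j, F_j |-> 0, K_j |-> 1; it shows that Uq is not the zero
   ring. *)
Definition counit_gen (g : gen) : K :=
  match g with GenE _ | GenF _ => 0 | _ => 1 end.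

Lemma counit_rel (f : {additive A -> K}) : f 1 = 1 ->
  {morph f : x y / x * y} -> (forall a x, f (a *: x) = a * f x) ->
  (forall g, f (X g) = counit_gen g) -> forall l r, DJ_rel l r -> f l = f r.
Proof.
move=> f1 fM fZ fX l r.
case=> [i j|i|i|i j|i j|i j|i j _|i j _]; rewrite /comm /qcomm.
- by rewrite !fM !fX.
- by rewrite fM !fX mulr1 f1.
- by rewrite fM !fX mulr1 f1.
- by rewrite !fM fZ !fX /= mulr0 mul0r mulr0.
- by rewrite !fM fZ !fX /= mulr0 mul0r mulr0.
- rewrite raddfB !fM !fX /= !mulr0 subrr; case: ifP => _; last by rewrite raddf0.
  by rewrite fZ raddfB !fX subrr mulr0.
- by rewrite raddfB !fM fX /= mul0r mulr0 subrr raddf0.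
- by rewrite raddfB !fM fX /= mul0r mulr0 subrr raddf0.
Qed.

End Relations.

Definition Uq_rel := DJ_rel (free_gen K (I := gen)).

(* U_q of affine sl_2, without derivation. *)
Definition Uq := quotalg Uq_rel.

HB.instance Definition _ := GRing.PzRing.on Uq.
HB.instance Definition _ := GRing.Lmodule.on Uq.

Let one_neq0 : 1 != 0 :> Uq.
Proof.
pose counit := free_eval (idfun : {rmorphism K -> K}) counit_gen.
have cM : {morph counit : x y / x * y}.
  by apply: free_evalM => a s; apply: mulrC.
have cZ a y : counit (a *: y) = a * counit y by apply: free_evalZ.
have cZ0 a y : counit y = 0 -> counit (a *: y) = 0.
  by rewrite cZ => ->; apply: mulr0.
have c1 : counit 1 = 1 by apply: free_eval1.
have c0 : counit 0 = 0 by apply: raddf0.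
have crel := counit_rel c1 cM cZ (free_eval_gen _ _).
apply/negP => /eqP e.
have e1 : counit 1 = counit 0 := quotalg_kernel (raddfB counit) cZ0 crel cM
  (e : quotalg_pi Uq_rel 1 = quotalg_pi Uq_rel 0).
by move: e1; rewrite c1 c0 => /eqP; rewrite oner_eq0.
Qed.

HB.instance Definition _ := GRing.PzSemiRing_isNonZero.Build Uq one_neq0.
HB.instance Definition _ :=
  GRing.Lmodule_isLalgebra.Build K Uq (@quotalg_scaleAl _ _ Uq_rel).
HB.instance Definition _ :=
  GRing.Lalgebra_isAlgebra.Build K Uq (@quotalg_scaleAr _ _ Uq_rel).

Definition Uq_gen (g : gen) : Uq := quotalg_pi Uq_rel (free_gen K g).

Section Morphism.
Variables (A B : algType K) (X : gen -> A) (Y : gen -> B) (f : A -> B).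
Hypotheses (fB : {morph f : x y / x - y}) (fM : {morph f : x y / x * y}).
Hypotheses (f1 : f 1 = 1) (fZ : scalable f) (fX : forall g, f (X g) = Y g).

Lemma DJ_rel_morph :
  (forall l r, DJ_rel X l r -> f l = f r) <-> (forall l r, DJ_rel Y l r -> l = r).
Proof.
have f0 : f 0 = 0 by rewrite -(subrr 0) fB subrr.
split=> H l r [i j|i|i|i j|i j|i j|i j ij|i j ij]; rewrite /comm /qcomm.
- by have := H _ _ (rel_KK X i j); rewrite !fM !fX.
- by have := H _ _ (rel_KKV X i); rewrite fM !fX f1.
- by have := H _ _ (rel_KVK X i); rewrite fM !fX f1.
- by have := H _ _ (rel_KE X i j); rewrite fZ !fM !fX.
- by have := H _ _ (rel_KF X i j); rewrite fZ !fM !fX.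
- by have := H _ _ (rel_EF X i j); rewrite (fun_if f) f0 fZ !fB !fM !fX.
- by have := H _ _ (rel_serreE X ij); rewrite f0 !(fB, fM, fZ, fX).
- by have := H _ _ (rel_serreF X ij); rewrite f0 !(fB, fM, fZ, fX).
- by have := H _ _ (rel_KK Y i j); rewrite !fM !fX.
- by have := H _ _ (rel_KKV Y i); rewrite fM !fX f1.
- by have := H _ _ (rel_KVK Y i); rewrite fM !fX f1.
- by have := H _ _ (rel_KE Y i j); rewrite fZ !fM !fX.
- by have := H _ _ (rel_KF Y i j); rewrite fZ !fM !fX.
- by have := H _ _ (rel_EF Y i j); rewrite (fun_if f) f0 fZ !fB !fM !fX.
- by have := H _ _ (rel_serreE Y ij); rewrite f0 !(fB, fM, fZ, fX).
- by have := H _ _ (rel_serreF Y ij); rewrite f0 !(fB, fM, fZ, fX).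
Qed.

End Morphism.

Definition Uq_pi : free_alg K gen -> Uq := quotalg_pi Uq_rel.

Lemma Uq_piB : {morph Uq_pi : x y / x - y}.
Proof. exact: (raddfB (quotalg_pi Uq_rel)). Qed.
Lemma Uq_piM : {morph Uq_pi : x y / x * y}.
Proof. exact: quotalg_piM. Qed.
Lemma Uq_piZ : scalable Uq_pi.
Proof. exact: quotalg_piZ. Qed.

HB.instance Definition _ :=
  GRing.isZmodMorphism.Build (free_alg K gen) Uq Uq_pi Uq_piB.
HB.instance Definition _ :=
  GRing.isMonoidMorphism.Build (free_alg K gen) Uq Uq_pi
    (conj (erefl _) Uq_piM).
HB.instance Definition _ :=
  GRing.isScalable.Build K (free_alg K gen) Uq *:%R Uq_pi Uq_piZ.

Lemma Uq_relE l r : DJ_rel Uq_gen l r -> l = r.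
Proof.
move: l r; apply/(DJ_rel_morph Uq_piB Uq_piM (erefl _) Uq_piZ (fun=> erefl _)).
by move=> l r; apply: quotalg_rel.
Qed.

Lemma Uq_ind (P : Uq -> Prop) : (forall x, P (Uq_pi x)) -> forall x, P x.
Proof. exact: quotalg_ind. Qed.

End Presentation.

Lemma Uq_lift (K : fieldType) (q : K) (B : algType K) (Y : gen -> B) :
  (forall l r, DJ_rel q Y l r -> l = r) ->
  exists f : {lrmorphism Uq q -> B}, forall g, f (Uq_gen q g) = Y g.
Proof.
move=> YP; pose e := free_eval (in_alg B) Y.
have eM : {morph e : x y / x * y}.
  by apply: free_evalM => a s; rewrite /GRing.comm /= mulr_algl mulr_algr.
have eZ a x : e (a *: x) = a *: e x by rewrite /e free_evalZ /= mulr_algl.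
have eB : {morph e : x y / x - y} by apply: raddfB.
have eX g : e (free_gen K g) = Y g by apply: free_eval_gen.
have e1 : e 1 = 1 by apply: free_eval1.
have eZ0 a x : e x = 0 -> e (a *: x) = 0 by rewrite eZ => ->; rewrite scaler0.
have erel := (DJ_rel_morph q eB eM e1 eZ eX).2 YP.
have epi x y : Uq_pi q x = Uq_pi q y -> e x = e y.
  exact: (quotalg_kernel eB eZ0 erel eM).
pose f (x : Uq q) := e (repr x).
have fpi x : f (Uq_pi q x) = e x by apply: epi; apply: quotmod_reprK.
have fB : zmod_morphism f.
  by elim/Uq_ind=> x; elim/Uq_ind=> y; rewrite -raddfB !fpi eB.
have fM : monoid_morphism f.
  split; first by rewrite -(rmorph1 (Uq_pi q)) fpi.
  by elim/Uq_ind=> x; elim/Uq_ind=> y; rewrite -rmorphM !fpi eM.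
have fZ : scalable f.
  by move=> a; elim/Uq_ind=> x; rewrite -Uq_piZ !fpi eZ.
pose fB' := GRing.isZmodMorphism.Build _ _ f fB.
pose fM' := GRing.isMonoidMorphism.Build _ _ f fM.
pose fZ' := GRing.isScalable.Build _ _ _ _ f fZ.
pose F : {lrmorphism Uq q -> B} := HB.pack f fB' fM' fZ'.
by exists F => g; rewrite /= fpi.
Qed.

Section RightAlternating.
Variables (K : fieldType) (q : K).

Local Notation U := (Uq q).
Local Notation E0 := (Uq_gen q (GenE ord0)).
Local Notation E1 := (Uq_gen q (GenE ord_max)).

Definition E_delta : U := E0 * E1 - q ^- 2 *: (E1 * E0).

(* E_alpha1 k and E_alpha0 k are the root vectors of weight k delta + alpha_1
   and k delta + alpha_0. *)
Fixpoint E_alpha1 (k : nat) : U :=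
  if k is k'.+1 then (q + q^-1)^-1 *: comm E_delta (E_alpha1 k') else E1.
Fixpoint E_alpha0 (k : nat) : U :=
  if k is k'.+1 then (q + q^-1)^-1 *: comm (E_alpha0 k') E_delta else E0.

Definition psi (k : nat) : U :=
  E_alpha0 k.-1 * E1 - q ^- 2 *: (E1 * E_alpha0 k.-1).

Definition psi_series : series U :=
  fun k => if k == 0%N then 1 else (q - q^-1) *: psi k.

(* E_ndelta n is the root vector of weight n delta, n >= 1, with the junk value
   0 at n = 0; see E_ndelta_exp for its defining equation. *)
Definition E_ndelta (n : nat) : U :=
  (q - q^-1)^-1 *: series_log psi_series n.

Lemma E_ndelta0 : E_ndelta 0 = 0.
Proof. by rewrite /E_ndelta series_log0 ?scaler0. Qed.

Lemma E_ndelta_exp : q - q^-1 != 0 ->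
  series_exp (fun k => (q - q^-1) *: E_ndelta k) = psi_series.
Proof.
move=> q1; rewrite (_ : (fun k => _) = series_log psi_series).
  by apply/funext => n; rewrite series_logK.
by apply/funext => k; rewrite /E_ndelta scalerA divff // scale1r.
Qed.

Lemma E_ndelta_unique (e : nat -> U) : q - q^-1 != 0 -> e 0%N = 0 ->
  series_exp (fun k => (q - q^-1) *: e k) = psi_series -> e = E_ndelta.
Proof.
move=> q1 e0 eE; apply/funext => n; rewrite /E_ndelta.
rewrite -(@series_log_unique _ _ (fun k => (q - q^-1) *: e k)).
- by rewrite scalerA mulVf // scale1r.
- by rewrite e0 scaler0.
- by [].
- by rewrite eE.
Qed.

(* All generating functions below are series in t = (q u^2)^-1. *)
Definition X_series : series U :=
  series_exp (fun n => - ((q - q^-1) / (q ^+ n + q ^- n)) *: E_ndelta n).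

Definition alpha1_series : series U :=
  fun n => if n is k.+1 then q ^+ k *: E_alpha1 k else 0.
Definition alpha0_series : series U :=
  fun n => if n is k.+1 then q ^+ k *: E_alpha0 k else 0.

(* The coefficient of U^(-k-1) in f(t), where U = q u^2 / (q + q^-1), that is,
   t = (q + q^-1)^-1 U^-1. *)
Definition coefU (f : series U) (k : nat) : U := (q + q^-1) ^- k.+1 *: f k.+1.

Definition rho_bar : K := - q * (q + q^-1) ^+ 2.

(* W_neg k, W_pos k, G_alt k, Gt_alt k are the right alternating generators
   W_{-k}, W_{k+1}, G_{k+1} and \tilde G_{k+1}. *)
Definition W_neg : nat -> U :=
  coefU (fun n => (q + q^-1) *: seriesM X_series alpha1_series n).
Definition W_pos : nat -> U :=
  coefU (fun n => (q + q^-1) *: seriesM alpha0_series X_series n).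
Definition G_alt : nat -> U :=
  coefU (fun n => (rho_bar / (q - q^-1)) *: (X_series n - series1 U n)).
Definition Gt_alt (k : nat) : U :=
  G_alt k + (q + q^-1) *: comm (W_neg 0) (W_pos k).

Lemma W_neg0 : q + q^-1 != 0 -> W_neg 0 = E1.
Proof.
move=> q1; rewrite /W_neg /coefU /seriesM big_ord_recl big_ord1 /= mulr0 addr0.
by rewrite /X_series series_exp0 mul1r expr0 scale1r scalerA mulVf ?scale1r.
Qed.

Lemma W_pos0 : q + q^-1 != 0 -> W_pos 0 = E0.
Proof.
move=> q1; rewrite /W_pos /coefU /seriesM big_ord_recl big_ord1 /= mul0r add0r.
by rewrite /X_series series_exp0 mulr1 expr0 scale1r scalerA mulVf ?scale1r.
Qed.

Definition right_alternating (x : U) : Prop :=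
  exists k, [\/ x = W_neg k, x = W_pos k, x = G_alt k | x = Gt_alt k].

Definition A_right := subalg_of right_alternating.

Definition Cartan_gen (x : U) : Prop :=
  exists i, x = Uq_gen q (GenK i) \/ x = Uq_gen q (GenKV i).

Definition U_zero := subalg_of Cartan_gen.

HB.instance Definition _ := GRing.Algebra.on A_right.
HB.instance Definition _ := GRing.Algebra.on U_zero.

End RightAlternating.

Section OmegaRel.
Variables (K : fieldType) (q : K) (qbar : {rmorphism K -> K}).
Hypotheses (q_neq0 : q != 0) (qbar_q : qbar q = q^-1).
Variables (A B : algType K).
Variables (X : gen -> A) (Y : gen -> B) (f : A -> B).
Hypotheses (fB : {morph f : x y / x - y}) (fM : forall x y, f (x * y) = f y * f x).
Hypotheses (f1 : f 1 = 1) (fZ : forall a x, f (a *: x) = qbar a *: f x).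
Hypotheses (fE : forall j, f (X (GenE j)) = Y (GenF j))
  (fF : forall j, f (X (GenF j)) = Y (GenE j))
  (fK : forall j, f (X (GenK j)) = Y (GenKV j))
  (fKV : forall j, f (X (GenKV j)) = Y (GenK j)).
Hypothesis YP : forall l r, DJ_rel q Y l r -> l = r.

Lemma Omega_rel l r : DJ_rel q X l r -> f l = f r.
Proof.
have f0 : f 0 = 0 by rewrite -(subrr 0) fB subrr.
have fcomm x y : f (comm x y) = - comm (f x) (f y).
  by rewrite /comm fB !fM opprB.
have fqcomm x y : f (qcomm q x y) = - qcomm q (f x) (f y).
  by rewrite /qcomm fB !fZ !fM fmorphV qbar_q invrK opprB.
have fqcommV x y : f (qcomm q^-1 x y) = - qcomm q^-1 (f x) (f y).
  by rewrite /qcomm fB !fZ !fM !fmorphV qbar_q invrK opprB.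
have qcommNr c x y : qcomm c x (- y) = - qcomm c x y :> B.
  by rewrite /qcomm mulrN mulNr !scalerN opprB opprK addrC.
have KVK i : Y (GenKV i) * Y (GenK i) = 1 := YP (rel_KVK q Y i).
have KKV i : Y (GenK i) * Y (GenKV i) = 1 := YP (rel_KKV q Y i).
have KK i j : Y (GenK i) * Y (GenK j) = Y (GenK j) * Y (GenK i).
  exact: YP (rel_KK q Y i j).
have qz (z : int) : qbar (q ^ z) = q ^ (- z).
  by rewrite rmorphXz ?unitfE ?q_neq0 // qbar_q exprz_inv.
case=> [i j|i|i|i j|i j|i j|i j ij|i j ij].
- rewrite !fM !fK.
  have aK : Y (GenKV j) * Y (GenKV i) * (Y (GenK i) * Y (GenK j)) = 1.
    by rewrite -mulrA (mulrA (Y (GenKV i))) KVK mul1r KVK.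
  have bK : Y (GenK j) * Y (GenK i) * (Y (GenKV i) * Y (GenKV j)) = 1.
    by rewrite -mulrA (mulrA (Y (GenK i))) KKV mul1r KKV.
  by rewrite -[LHS]mulr1 -bK mulrA (KK j i) aK mul1r.
- by rewrite fM fK fKV f1.
- by rewrite fM fK fKV f1.
- by rewrite !fM fZ fK fKV fE qz mulrA; apply: YP (rel_KF q Y i j).
- rewrite !fM fZ fK fKV fF qz opprK mulrA; apply: YP (rel_KE q Y i j).
- rewrite fcomm fE fF (fun_if f) f0 fZ fB fK fKV fmorphV rmorphB /=.
  rewrite fmorphV qbar_q invrK.
  have := YP (rel_EF q Y j i); rewrite /comm opprB => ->.
  rewrite eq_sym; case: eqP => // ->.
  by rewrite -[q^-1 - q]opprB invrN scaleNr -scalerN opprB.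
- rewrite fcomm fqcommV fqcomm !fE qcommNr opprK f0.
  by rewrite (YP (rel_serreF q Y ij)) oppr0.
- rewrite fcomm fqcommV fqcomm !fF qcommNr opprK f0.
  by rewrite (YP (rel_serreE q Y ij)) oppr0.
Qed.

End OmegaRel.

Section AntiEval.
Variables (K : fieldType) (I : choiceType) (s : {rmorphism K -> K}).
Variables (A : algType K) (h : I -> A).

Definition conv_scalar (a : K) : A^c := ((s a)%:A : A).

Let conv_scalar_zmod : zmod_morphism conv_scalar.
Proof.
move=> a b; rewrite /conv_scalar raddfB -[RHS]/((s a)%:A - (s b)%:A : A).
exact: scalerBl.
Qed.
Let conv_scalar_monoid : monoid_morphism conv_scalar.
Proof.
rewrite /conv_scalar; split; first by rewrite rmorph1; apply: scale1r.
move=> a b; rewrite -[RHS]/((s b)%:A * (s a)%:A : A).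
by rewrite rmorphM mulr_algl scalerA mulrC.
Qed.
HB.instance Definition _ :=
  GRing.isZmodMorphism.Build K A^c conv_scalar conv_scalar_zmod.
HB.instance Definition _ :=
  GRing.isMonoidMorphism.Build K A^c conv_scalar conv_scalar_monoid.

(* The s-semilinear antimorphism from the free algebra on I that extends h. *)
Definition anti_eval (x : free_alg K I) : A :=
  free_eval (S := A^c) conv_scalar h x.

Lemma anti_evalB : {morph anti_eval : x y / x - y}.
Proof. exact: (raddfB (free_eval (S := A^c) conv_scalar h)). Qed.
Lemma anti_eval1 : anti_eval 1 = 1.
Proof. exact: (free_eval1 (S := A^c)). Qed.
Lemma anti_eval_gen i : anti_eval (free_gen K i) = h i.
Proof. exact: (free_eval_gen (S := A^c)). Qed.
Lemma anti_evalM x y : anti_eval (x * y) = anti_eval y * anti_eval x.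
Proof.
apply: (free_evalM (S := A^c)) => a t.
change (@GRing.mul A t (s a)%:A = @GRing.mul A (s a)%:A t).
by rewrite mulr_algl mulr_algr.
Qed.
Lemma anti_evalZ a x : anti_eval (a *: x) = s a *: anti_eval x.
Proof.
rewrite -[RHS]mulr_algr; apply: (free_evalZ (S := A^c)).
Qed.

End AntiEval.

Section Omega.
Variables (K : fieldType) (q : K) (qbar : {rmorphism K -> K}).
Local Notation U := (Uq q).

Definition Omega_gen (g : gen) : U :=
  match g with
  | GenE j => Uq_gen q (GenF j) | GenF j => Uq_gen q (GenE j)
  | GenK j => Uq_gen q (GenKV j) | GenKV j => Uq_gen q (GenK j)
  end.

Definition Omega_free : free_alg K gen -> U := anti_eval qbar Omega_gen.

(* The qbar-semilinear antiautomorphism Omega, for qbar q = q^-1. The choice of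
   a representative in the free algebra is irrelevant by Omega_pi. *)
Definition Omega (x : U) : U := Omega_free (repr x).

Definition left_alternating (x : U) : Prop :=
  exists2 y, right_alternating y & x = Omega y.

Definition A_left := subalg_of left_alternating.

HB.instance Definition _ := GRing.Algebra.on A_left.

Hypotheses (q_neq0 : q != 0) (qbar_q : qbar q = q^-1).

Let Omega_free_eq x y : Uq_pi q x = Uq_pi q y -> Omega_free x = Omega_free y.
Proof.
have F0 a z : Omega_free z = 0 -> Omega_free (a *: z) = 0.
  by rewrite /Omega_free anti_evalZ => ->; rewrite scaler0.
apply: (quotalg_antikernel (anti_evalB qbar Omega_gen) F0);
  last exact: (anti_evalM qbar Omega_gen).
have gE g : Omega_free (free_gen K g) = Omega_gen g by apply: anti_eval_gen.
exact: (Omega_rel q_neq0 qbar_q (anti_evalB qbar Omega_gen)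
  (anti_evalM qbar Omega_gen) (anti_eval1 _ _) (anti_evalZ qbar Omega_gen)
  (fun j => gE (GenE j)) (fun j => gE (GenF j))
  (fun j => gE (GenK j)) (fun j => gE (GenKV j)) (@Uq_relE _ q)).
Qed.

Lemma Omega_pi x : Omega (Uq_pi q x) = Omega_free x.
Proof. by apply: Omega_free_eq; apply: quotmod_reprK. Qed.

Lemma Omega_zmod : zmod_morphism Omega.
Proof.
by elim/Uq_ind=> x; elim/Uq_ind=> y; rewrite -raddfB !Omega_pi -anti_evalB.
Qed.

Lemma OmegaM x y : Omega (x * y) = Omega y * Omega x.
Proof.
elim/Uq_ind: x => x; elim/Uq_ind: y => y.
by rewrite -rmorphM !Omega_pi -anti_evalM.
Qed.

Lemma Omega1 : Omega 1 = 1.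
Proof. by rewrite -(rmorph1 (Uq_pi q)) Omega_pi; apply: anti_eval1. Qed.

Lemma OmegaZ a x : Omega (a *: x) = qbar a *: Omega x.
Proof. by elim/Uq_ind: x => x; rewrite -Uq_piZ !Omega_pi -anti_evalZ. Qed.

Lemma Omega_genE g : Omega (Uq_gen q g) = Omega_gen g.
Proof. by rewrite Omega_pi; apply: anti_eval_gen. Qed.

End Omega.


Lemma sub_inv_neq0 (F : fieldType) (a : F) :
  a != 0 -> a ^+ 2 - 1 != 0 -> a - a^-1 != 0.
Proof.
by move=> a0; apply: contra => /eqP e; rewrite -(divff a0) expr2 -mulrBr e mulr0.
Qed.

Lemma add_inv_neq0 (F : fieldType) (a : F) :
  a != 0 -> a ^+ 2 + 1 != 0 -> a + a^-1 != 0.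
Proof.
by move=> a0; apply: contra => /eqP e; rewrite -(divff a0) expr2 -mulrDr e mulr0.
Qed.

Section RationalFunctions.
Variable C : fieldType.

(* The field C(q). *)
Definition ratfun := {fraction {poly C}}.
HB.instance Definition _ := GRing.Field.on ratfun.

Definition ratfun_const (c : C) : ratfun := tofrac c%:P.
Lemma ratfun_const_zmod : zmod_morphism ratfun_const.
Proof. by move=> x y; rewrite /ratfun_const !raddfB. Qed.
Lemma ratfun_const_monoid : monoid_morphism ratfun_const.
Proof. by split=> [|x y]; rewrite /ratfun_const ?rmorph1 ?rmorphM. Qed.
HB.instance Definition _ :=
  GRing.isZmodMorphism.Build C ratfun ratfun_const ratfun_const_zmod.
HB.instance Definition _ :=
  GRing.isMonoidMorphism.Build C ratfun ratfun_const ratfun_const_monoid.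

Definition qvar : ratfun := tofrac 'X.

Lemma qvar_neq0 : qvar != 0.
Proof. by rewrite tofrac_eq0 polyX_eq0. Qed.

Lemma qvar_sub_neq0 : qvar - qvar^-1 != 0.
Proof.
apply: (sub_inv_neq0 qvar_neq0); rewrite /qvar -tofracXn -tofrac1 -tofracB.
rewrite tofrac_eq0; apply/eqP => /(congr1 (fun p : {poly C} => p`_2)).
by rewrite coefB coefXn coef1 coef0 subr0 => /eqP; rewrite oner_eq0.
Qed.

Lemma qvar_add_neq0 n : (0 < n)%N -> qvar ^+ n + qvar ^- n != 0.
Proof.
move=> n0; apply: (add_inv_neq0 (expf_neq0 _ qvar_neq0)).
rewrite /qvar -2!tofracXn -tofrac1 -tofracD -exprM tofrac_eq0.
apply/eqP => /(congr1 (fun p : {poly C} => p`_(n * 2))).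
rewrite coefD coefXn coef1 coef0 eqxx muln_eq0 (gtn_eqF n0) addr0 => /eqP.
by rewrite oner_eq0.
Qed.

(* p(q^-1) for a polynomial p, and the automorphism q |-> q^-1 of C(q). *)
Definition eval_qinv (p : {poly C}) : ratfun :=
  (map_poly ratfun_const p).[qvar^-1].
Definition qbar (x : ratfun) : ratfun :=
  eval_qinv (\n_(repr x)) / eval_qinv (\d_(repr x)).

Lemma eval_qinv_neq0 p : p != 0 -> eval_qinv p != 0.
Proof.
move=> p0; pose m := (size p).-1.
pose P := \sum_(i < size p) p`_i *: 'X^(m - i).
have sp : (0 < size p)%N by rewrite size_poly_gt0.
have mE : m.+1 = size p by rewrite prednK.
have P0 : P != 0.
  apply/eqP => /(congr1 (fun r : {poly C} => r`_0)); rewrite coef0 coef_sum.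
  have lt_m : (m < size p)%N by rewrite -mE.
  rewrite (bigD1 (Ordinal lt_m)) //= subnn coefZ coefXn eqxx mulr1 big1.
    by rewrite addr0 => /eqP; rewrite -lead_coefE lead_coef_eq0 (negPf p0).
  move=> i im; rewrite coefZ coefXn eq_sym subn_eq0.
  rewrite leqNgt; suff -> : (i < m)%N by rewrite mulr0.
  rewrite ltn_neqAle -ltnS mE ltn_ord andbT.
  by apply: contra im => /eqP e; apply/eqP/val_inj.
have : qvar ^+ m * eval_qinv p = tofrac P.
  rewrite /eval_qinv horner_coef mulr_sumr (rmorph_sum (tofrac (R := {poly C}))) /=.
  rewrite size_map_inj_poly ?rmorph0 //; last exact: fmorph_inj.
  apply: eq_bigr => i _; rewrite coef_map /= -mul_polyC tofracM tofracXn.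
  rewrite mulrCA; congr (_ * _); rewrite -/qvar exprVn.
  have im : (i <= m)%N by rewrite -ltnS mE.
  by rewrite -{1}(subnK im) exprD mulfK // expf_neq0 // qvar_neq0.
by move=> e; apply: contra P0 => /eqP p1; rewrite -tofrac_eq0 -e p1 mulr0.
Qed.

Lemma ratfunE (x : ratfun) :
  x = tofrac (\n_(repr x)) / tofrac (\d_(repr x)).
Proof.
rewrite -[LHS]reprK; move: (repr x) => r; unlock tofrac.
rewrite -[_^-1]FracField.pi_inv -[RHS]FracField.pi_mul.
rewrite /FracField.invf /FracField.mulf !numden_Ratio ?oner_neq0 ?denom_ratioP //.
by rewrite mulr1 mul1r Ratio_numden.
Qed.

Let eval_qinvD : {morph eval_qinv : p r / p + r}.
Proof. by move=> p r; rewrite /eval_qinv rmorphD hornerD. Qed.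
Let eval_qinvN p : eval_qinv (- p) = - eval_qinv p.
Proof. by rewrite /eval_qinv rmorphN hornerN. Qed.
Let eval_qinvM : {morph eval_qinv : p r / p * r}.
Proof. by move=> p r; rewrite /eval_qinv rmorphM hornerM. Qed.
Let eval_qinvC c : eval_qinv c%:P = ratfun_const c.
Proof. by rewrite /eval_qinv map_polyC hornerC. Qed.

Lemma qbar_div n d : d != 0 ->
  qbar (tofrac n / tofrac d) = eval_qinv n / eval_qinv d.
Proof.
move=> d0; rewrite /qbar; set x := tofrac n / _.
have r0 : \d_(repr x) != 0 by apply: denom_ratioP.
apply/eqP; rewrite eqr_div ?eval_qinv_neq0 // -!eval_qinvM; apply/eqP.
congr eval_qinv; apply/eqP; rewrite -tofrac_eq !tofracM.
by rewrite -eqr_div ?tofrac_eq0 // -ratfunE.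
Qed.

Lemma qbar_zmod : zmod_morphism qbar.
Proof.
move=> x y; rewrite [x]ratfunE [y]ratfunE.
move: (denom_ratioP (repr x)) (denom_ratioP (repr y)).
move: (\n_(repr x)) (\d_(repr x)) (\n_(repr y)) (\d_(repr y)) => a b c d b0 d0.
rewrite -mulNr addf_div ?tofrac_eq0 // -tofracN -!tofracM -tofracD.
rewrite !qbar_div ?mulf_neq0 // -mulNr addf_div ?eval_qinv_neq0 //.
by rewrite eval_qinvD !eval_qinvM eval_qinvN.
Qed.

Lemma qbar_monoid : monoid_morphism qbar.
Proof.
split=> [|x y].
  rewrite -(divr1 1) -tofrac1 qbar_div ?oner_neq0 //.
  by rewrite eval_qinvC ?rmorph1 !divr1 ?tofrac1.
rewrite [x]ratfunE [y]ratfunE.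
move: (denom_ratioP (repr x)) (denom_ratioP (repr y)).
move: (\n_(repr x)) (\d_(repr x)) (\n_(repr y)) (\d_(repr y)) => a b c d b0 d0.
rewrite mulf_div -!tofracM !qbar_div ?mulf_neq0 // mulf_div.
by rewrite !eval_qinvM.
Qed.

HB.instance Definition _ := GRing.isZmodMorphism.Build ratfun ratfun qbar
  qbar_zmod.
HB.instance Definition _ := GRing.isMonoidMorphism.Build ratfun ratfun qbar
  qbar_monoid.

Let qbar_tofrac p : qbar (tofrac p) = eval_qinv p.
Proof.
rewrite -[tofrac p]divr1 -tofrac1 qbar_div ?oner_neq0 //.
by rewrite eval_qinvC rmorph1 divr1.
Qed.

Lemma qbar_const c : qbar (ratfun_const c) = ratfun_const c.
Proof. by rewrite qbar_tofrac eval_qinvC. Qed.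

Lemma qbar_qvar : qbar qvar = qvar^-1.
Proof. by rewrite qbar_tofrac /eval_qinv map_polyX hornerX. Qed.

End RationalFunctions.

(* Main.v *)
From HB Require Import structures.
Require Import Defs.
From mathcomp Require Import all_boot all_order all_algebra.
From mathcomp Require Import boolp functions finmap monalg.
From mathcomp Require Import reals complex ring.

Set Implicit Arguments.
Unset Strict Implicit.
Unset Printing Implicit Defensive.

Import GRing.Theory.
Local Open Scope ring_scope.

(* The right (left) alternating generators lie in the subalgebra generated by
   the E_j (the F_j) and include the E_j (the F_j) themselves, so the theorem is
   the triangular decomposition of U_q. The relation [E_i, F_j] shows that the
   monomials E_w K^t F_y span U_q. For injectivity, let the generators act on the
   free module with basis the triples (w, t, y): E_j prepends a letter to w, K_j
   shifts t, and F_j is moved past w by its commutator with each letter. All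
   relations but the Serre relations hold, and E_w K^t F_y maps ([], 0, []) to
   (w, t, y), so a linear functional may be prescribed on these monomials; take
   E_w K^t F_y |-> E_w (x) K^t (x) F_y. The Serre elements in the E_j (the F_j)
   commute with the F_j (the E_j) and commute with the K_j up to a power of q,
   hence every a * S * b with S a Serre element rewrites to monomials containing S
   inside their E-part (F-part), where the functional vanishes. It therefore
   descends to U_q and inverts the multiplication map. *)

(** * Free modules and their algebras of linear endomorphisms *)

Section FreeModule.
Variables (K : fieldType) (B : choiceType).
Local Notation M := {malg K[B]}.

Lemma malg_basisE (x : M) : x = \sum_(b <- msupp x) x@_b *: (<< b >> : M).
Proof.
rewrite {1}[x]monalgE; apply: eq_bigr => b _.
by apply/malgP => c; rewrite mcoeffZ !mcoeffU mulr_natr.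
Qed.

Lemma malg_linear_eq (V : lmodType K) (f g : {linear M -> V}) :
  (forall b, f << b >> = g << b >>) -> f =1 g.
Proof.
move=> fg x; rewrite [x]malg_basisE !linear_sum.
by apply: eq_bigr => b _; rewrite !linearZ fg.
Qed.

Lemma malg_ind (P : M -> Prop) : P 0 ->
  (forall a x y, P x -> P y -> P (a *: x + y)) -> (forall b, P << b >>) ->
  forall x, P x.
Proof.
move=> P0 Plin Pb x; rewrite [x]malg_basisE.
by apply: big_ind => // [y z Py Pz | b _];
  [rewrite -[y]scale1r; apply: Plin | rewrite -[_ *: _]addr0; apply: Plin].
Qed.

Variables (V : lmodType K) (f : B -> V).

Definition malg_lift (x : M) : V := \sum_(b <- msupp x) x@_b *: f b.

(** Terms outside the support have coefficient 0, so the index set can be enlarged; linearity then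
    compares three sums over a common [d]. *)
Lemma malg_liftEw (d : {fset B}) x : (msupp x `<=` d)%fset ->
  malg_lift x = \sum_(b <- d) x@_b *: f b.
Proof.
move=> xd; rewrite /malg_lift (big_fset_incl _ xd) // => b _ /mcoeff_outdom ->.
by rewrite scale0r.
Qed.

Lemma malg_lift_linear : linear malg_lift.
Proof.
move=> a x y; pose d := (msupp x `|` msupp y `|` msupp (a *: x + y))%fset.
rewrite (@malg_liftEw d x) ?(@malg_liftEw d y) ?(@malg_liftEw d (a *: x + y));
  try by apply/fsubsetP => b; rewrite !in_fsetE => ->; rewrite ?orbT.
rewrite scaler_sumr -big_split /=.
by apply: eq_bigr => b _; rewrite mcoeffD mcoeffZ scalerDl scalerA.
Qed.

HB.instance Definition _ :=
  GRing.isLinear.Build K M V *:%R malg_lift malg_lift_linear.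

Lemma malg_lift_basis b : malg_lift << b >> = f b.
Proof.
rewrite (@malg_liftEw [fset b]%fset) ?msuppU_le //.
by rewrite big_seq_fset1 mcoeffUU scale1r.
Qed.

End FreeModule.

Section LinearEndomorphisms.
Variables (K : fieldType) (V : lmodType K).

(** Cutting the linear maps out of the function space as a submodule lets [lin_end] inherit its
    module structure; only composition remains to be supplied. *)
Definition is_linear : {pred V -> V} := fun f => `[< linear f >].

Lemma is_linear_submod_closed : submod_closed is_linear.
Proof.
split=> [|a f g /asboolP fP /asboolP gP]; apply/asboolP => c x y.
  by rewrite scaler0 addr0.
change (a *: f (c *: x + y) + g (c *: x + y)
  = c *: (a *: f x + g x) + (a *: f y + g y)).
by rewrite fP gP !scalerDr !scalerA mulrC addrACA.
Qed.

HB.instance Definition _ := GRing.isSubmodClosed.Build K (V -> V) is_linear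
  (GRing.submod_closed_semi is_linear_submod_closed).

Definition lin_end := {f : V -> V | f \in is_linear}.

HB.instance Definition _ := SubType.on lin_end.
HB.instance Definition _ := Choice.on lin_end.
HB.instance Definition _ := [SubChoice_isSubLmodule of lin_end by <:].

Lemma lin_endP (f : lin_end) : linear (\val f).
Proof. exact/asboolP/(valP f). Qed.

Definition lin_end_fun (f : lin_end) : V -> V := \val f.
HB.instance Definition _ (f : lin_end) :=
  GRing.isLinear.Build K V V *:%R (lin_end_fun f) (lin_endP f).

Lemma lin_end_ext (f g : lin_end) : lin_end_fun f =1 lin_end_fun g -> f = g.
Proof. by move=> fg; apply/val_inj/funext. Qed.

Definition lin_end_of (f : {linear V -> V}) : lin_end :=
  Sub (f : V -> V) (introT (asboolP (linear f)) (linearP f)).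

Definition lin_end_one : lin_end := lin_end_of idfun.
Definition lin_end_mul (f g : lin_end) : lin_end :=
  lin_end_of (lin_end_fun f \o lin_end_fun g).

Let mulA : associative lin_end_mul.
Proof. by move=> f g h; apply: lin_end_ext. Qed.
Let mul1 : left_id lin_end_one lin_end_mul.
Proof. by move=> f; apply: lin_end_ext. Qed.
Let mulr1' : right_id lin_end_one lin_end_mul.
Proof. by move=> f; apply: lin_end_ext. Qed.
Let mulDl : left_distributive lin_end_mul +%R.
Proof. by move=> f g h; apply: lin_end_ext. Qed.
Let mulDr : right_distributive lin_end_mul +%R.
Proof. by move=> f g h; apply: lin_end_ext => x; exact: linearD (lin_end_fun f) _ _. Qed.

HB.instance Definition _ :=
  GRing.Zmodule_isPzRing.Build lin_end mulA mul1 mulr1' mulDl mulDr.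

End LinearEndomorphisms.

Section FreeModuleEndomorphisms.
Variables (K : fieldType) (B : choiceType) (b0 : B).

(* The point b0 of B makes the endomorphism ring nonzero. *)
Definition malg_end (b : B) := lin_end {malg K[B]}.
Local Notation End := (malg_end b0).

HB.instance Definition _ := GRing.PzRing.on End.
HB.instance Definition _ := GRing.Lmodule.on End.

Let one_neq0 : 1 != 0 :> End.
Proof.
apply/eqP => /(congr1 (fun f : End => (lin_end_fun f << b0 >>)@_b0)) /eqP.
by rewrite mcoeffUU mcoeff0 oner_eq0.
Qed.

HB.instance Definition _ := GRing.PzSemiRing_isNonZero.Build End one_neq0.

Let scaleAl (a : K) (f g : End) : a *: (f * g) = (a *: f) * g.
Proof. by apply: lin_end_ext. Qed.
HB.instance Definition _ := GRing.Lmodule_isLalgebra.Build K End scaleAl.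

Let scaleAr (a : K) (f g : End) : a *: (f * g) = f * (a *: g).
Proof.
apply: lin_end_ext => x.
exact: (esym (linearZZ (lin_end_fun f) a (lin_end_fun g x))).
Qed.
HB.instance Definition _ := GRing.Lalgebra_isAlgebra.Build K End scaleAr.

Lemma malg_end_ext (f g : End) :
  (forall b, lin_end_fun f << b >> = lin_end_fun g << b >>) -> f = g.
Proof. by move=> fg; apply: lin_end_ext; apply: malg_linear_eq. Qed.

Definition malg_end_of (f : B -> {malg K[B]}) : End := lin_end_of (malg_lift f).

Lemma malg_end_ofE f b : lin_end_fun (malg_end_of f) << b >> = f b.
Proof. exact: malg_lift_basis. Qed.

End FreeModuleEndomorphisms.

(** The exponent vector of [K_i] in the lattice that indexes the monomials K^t. *)
Definition unit_wt (i : 'I_2) : int * int := if i == ord0 then (1, 0) else (0, 1).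

Lemma unit_wtE (t : int * int) :
  unit_wt ord0 *~ t.1 + unit_wt ord_max *~ t.2 = t.
Proof.
case: t => a b; rewrite [LHS]surjective_pairing.
by rewrite !raddfD !raddfMz /= !mul0rz !intz addr0 add0r.
Qed.

Lemma ord2P (i : 'I_2) : i = ord0 \/ i = ord_max.
Proof. by case: i => [[|[|]]] // ?; [left | right]; apply: val_inj. Qed.

(** * Algebras with all relations but the Serre relations *)

Section SkewRelations.
Variables (K : fieldType) (q : K).

(* The Drinfeld-Jimbo relations other than the Serre relations. *)
Record skew_rel (A : algType K) (X : gen -> A) : Prop := SkewRel {
  skew_KK : forall i j, X (GenK i) * X (GenK j) = X (GenK j) * X (GenK i);
  skew_KKV : forall i, X (GenK i) * X (GenKV i) = 1;
  skew_KVK : forall i, X (GenKV i) * X (GenK i) = 1;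
  skew_KE : forall i j,
    X (GenK i) * X (GenE j) = q ^ cartan i j *: (X (GenE j) * X (GenK i));
  skew_KF : forall i j,
    X (GenK i) * X (GenF j) = q ^ (- cartan i j) *: (X (GenF j) * X (GenK i));
  skew_EF : forall i j, comm (X (GenE i)) (X (GenF j)) =
    if i == j then (q - q^-1)^-1 *: (X (GenK i) - X (GenKV i)) else 0
}.

Definition serre (A : algType K) (x y : A) : A :=
  comm x (qcomm q^-1 x (qcomm q x y)).

Lemma DJ_rel_skew (A : algType K) (X : gen -> A) : q != 0 ->
  (forall l r, DJ_rel q X l r -> l = r) -> skew_rel X.
Proof.
move=> q0 H; split.
- by move=> i j; apply: H; constructor.
- by move=> i; apply: H; constructor.
- by move=> i; apply: H; constructor.
- move=> i j; rewrite scalerAl -(H _ _ (rel_KE q X i j)).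
  by rewrite -(mulrA _ _ (X (GenK i))) (H _ _ (rel_KVK q X i)) mulr1.
- move=> i j; rewrite scalerAl -(H _ _ (rel_KF q X i j)).
  by rewrite -(mulrA _ _ (X (GenK i))) (H _ _ (rel_KVK q X i)) mulr1.
- by move=> i j; apply: H; constructor.
Qed.

(** The Chevalley involution on generators. Composition with it preserves [skew_rel] with the same
    [q], so results on the E-part transfer to the F-part. *)
Definition chevalley (g : gen) : gen :=
  match g with
  | GenE j => GenF j | GenF j => GenE j | GenK j => GenKV j | GenKV j => GenK j
  end.

Section Skew.
Variables (A : algType K) (X : gen -> A).
Hypotheses (q0 : q != 0) (X_rel : skew_rel X).

Local Notation E j := (X (GenE j)).
Local Notation F j := (X (GenF j)).
Local Notation "'K_ j" := (X (GenK j)) (at level 8, j at level 2).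
Local Notation "'KV_ j" := (X (GenKV j)) (at level 8, j at level 2).

Let qz0 n : q ^ n != 0. Proof. by rewrite expfz_neq0. Qed.

(** Multiply the hypothesis by the inverse of [K_i] on both sides. The case [n = 0] says that this
    inverse commutes with whatever [K_i] commutes with. *)
Lemma skew_KVx i (x : A) n : 'K_i * x = q ^ n *: (x * 'K_i) ->
  'KV_i * x = q ^ (- n) *: (x * 'KV_i).
Proof.
move=> e; apply: (scalerI (qz0 n)); rewrite scalerA -expfzDr // subrr scale1r.
rewrite -[x in RHS]mul1r -(skew_KVK X_rel i) -(mulrA 'KV_i) e.
by rewrite -scalerAr -scalerAl -!mulrA (skew_KKV X_rel) mulr1.
Qed.

Lemma skew_KVE i j : 'KV_i * E j = q ^ (- cartan i j) *: (E j * 'KV_i).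
Proof. exact/skew_KVx/skew_KE. Qed.

Lemma skew_KVF i j : 'KV_i * F j = q ^ cartan i j *: (F j * 'KV_i).
Proof. by rewrite -[cartan i j]opprK; apply/skew_KVx/skew_KF. Qed.

Lemma skew_KVKV i j : 'KV_i * 'KV_j = 'KV_j * 'KV_i.
Proof.
have KVK a b : 'KV_a * 'K_b = 'K_b * 'KV_a.
  have := @skew_KVx a 'K_b 0; rewrite oppr0 expr0z !scale1r; apply.
  exact: skew_KK.
have := @skew_KVx i 'KV_j 0; rewrite oppr0 expr0z !scale1r; apply.
by rewrite KVK.
Qed.

Lemma skew_chevalley : skew_rel (X \o chevalley).
Proof.
split=> /=.
- exact: skew_KVKV.
- exact: skew_KVK.
- exact: skew_KKV.
- exact: skew_KVF.
- exact: skew_KVE.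
- move=> i j; have := skew_EF X_rel j i; rewrite /comm => e.
  rewrite -opprB e eq_sym; case: eqP => [->|_]; last exact: oppr0.
  by rewrite -scalerN opprB.
Qed.

(** The quantum integer [3], which is also both middle quantum binomials of 3 in the expanded Serre
    relation. *)
Definition qthree : K := q ^+ 2 + 1 + q ^- 2.

Lemma serreE (x y : A) : serre x y =
  x * x * x * y - qthree *: (x * x * y * x) + qthree *: (x * y * x * x)
  - y * x * x * x.
Proof.
have qq : q * q^-1 = 1 by apply: mulfV.
have qq' : q^-1 * q = 1 by apply: mulVf.
have -> : qthree = q * q + 1 + q^-1 * q^-1.
  by rewrite /qthree -exprVn !expr2.
(* The two inner brackets produce the coefficient q^2 + q^-2; the outer commutator adds the 1 that
   completes [3]. *)
have y2E : qcomm q^-1 x (qcomm q x y) =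
    x * x * y - (q * q + q^-1 * q^-1) *: (x * y * x) + y * x * x.
  rewrite /qcomm invrK mulrBr mulrBl -!scalerAr -!scalerAl !scalerBr !scalerA.
  rewrite qq qq' !scale1r !mulrA scalerDl !opprD opprK !addrA; congr (_ + _).
  by rewrite addrAC.
rewrite /serre /comm y2E mulrDr mulrBr mulrDl mulrBl -scalerAr -scalerAl !mulrA.
rewrite addrAC -addrA; move: (x * x * x * y) (x * x * y * x) (x * y * x * x).
move: (y * x * x * x) => m3 m0 m1 m2; rewrite [q * q + 1 + _]addrAC.
move: (q * q + _) => p; rewrite !scalerDl !scale1r !opprD opprK !addrA.
rewrite [LHS]addrAC; congr (_ - _).
Qed.

(** Usually written [K_i; n]. At [n = 0] it is [E_i, F_i], and the shift [n] records the letters E_j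
    that it has crossed. *)
Definition skew_h i (n : int) : A :=
  (q - q^-1)^-1 *: (q ^ n *: 'K_i - q ^ (- n) *: 'KV_i).

Lemma skew_hE i j n : skew_h i n * E j = E j * skew_h i (n + cartan i j).
Proof.
rewrite /skew_h -scalerAl -scalerAr mulrBl mulrBr -!scalerAl -!scalerAr.
rewrite (skew_KE X_rel) skew_KVE !scalerA.
by rewrite opprD !expfzDr.
Qed.

(** Both the [K_i] term and the [K_i^-1] term are multiplied by q^2, 1 and q^-2 in some order, and
    these add up to [3]. *)
Lemma skew_h3 i n :
  skew_h i (n + 2) + skew_h i n + skew_h i (n - 2) = qthree *: skew_h i n.
Proof.
have q2 m : q ^ (m + 2) = q ^ m * q ^+ 2 by rewrite expfzDr.
have qm2 m : q ^ (m - 2) = q ^ m * q ^- 2 by rewrite expfzDr.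
rewrite /skew_h [RHS]scalerA [_ * (_)^-1]mulrC -[RHS]scalerA -!scalerDr.
have zD a a' b b' (u v : A) :
    (a *: u - a' *: v) + (b *: u - b' *: v) = (a + b) *: u - (a' + b') *: v.
  by rewrite addrACA -opprD -!scalerDl.
congr (_ *: _); rewrite !zD scalerBr !scalerA opprB !opprD [2 - n]addrC !q2 !qm2 /qthree.
by congr (_ *: _ - _ *: _); ring.
Qed.

Lemma skew_EFh i j :
  comm (E i) (F j) = if i == j then skew_h i 0 else 0.
Proof. by rewrite (skew_EF X_rel) /skew_h oppr0 expr0z !scale1r. Qed.

Lemma commMl (x y f : A) : comm (x * y) f = comm x f * y + x * comm y f.
Proof. by rewrite /comm mulrBl mulrBr !mulrA [RHS]addrC addrA subrK. Qed.

Lemma commDl (x y f : A) : comm (x + y) f = comm x f + comm y f.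
Proof. by rewrite /comm mulrDl mulrDr opprD addrACA. Qed.

Lemma commZl a (x f : A) : comm (a *: x) f = a *: comm x f.
Proof. by rewrite /comm -scalerAl -scalerAr scalerBr. Qed.

Lemma commBl (x y f : A) : comm (x - y) f = comm x f - comm y f.
Proof. by rewrite commDl -scaleN1r commZl scaleN1r. Qed.

Lemma comm_serre (x y f : A) : comm (serre x y) f =
  comm (x * x * x * y) f - qthree *: comm (x * x * y * x) f
  + qthree *: comm (x * y * x * x) f - comm (y * x * x * x) f.
Proof.
by rewrite serreE !commBl commDl commBl !commZl.
Qed.

Lemma cartan2 i : cartan i i = 2. Proof. by rewrite /cartan eqxx. Qed.
Lemma cartanN2 i j : i != j -> cartan i j = - 2.
Proof. by rewrite /cartan => /negPf->. Qed.

(* Every term of the commutator is moved to the form (word in E_i, E_j) * h_n;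
   the coefficient [3] of the Serre element then cancels the sums
   h_(n+2) + h_n + h_(n-2) = [3] h_n. *)
Lemma comm_serreE_F_diag i j : i != j -> comm (serre (E i) (E j)) (F i) = 0.
Proof.
move=> ij; rewrite comm_serre !commMl.
have -> : comm (E i) (F i) = skew_h i 0 by rewrite skew_EFh eqxx.
have -> : comm (E j) (F i) = 0 by rewrite skew_EFh eq_sym (negPf ij).
have hx n : skew_h i n * E i = E i * skew_h i (n + 2).
  by rewrite skew_hE cartan2.
have hy n : skew_h i n * E j = E j * skew_h i (n - 2).
  by rewrite skew_hE cartanN2.
have hxz n (z : A) : skew_h i n * (E i * z) = E i * (skew_h i (n + 2) * z).
  by rewrite mulrA skew_hE cartan2 mulrA.
have hyz n (z : A) : skew_h i n * (E j * z) = E j * (skew_h i (n - 2) * z).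
  by rewrite mulrA skew_hE cartanN2 // mulrA.
rewrite !(mulr0, mul0r, addr0, add0r) !mulrDl -!mulrA.
rewrite !(hx, hxz, hy, hyz) !(subrK, addrK) -4!mulrDr -4!mulrDr.
have h3 := skew_h3 i 0; have := skew_h3 i (0 + 2); rewrite addrK => h3'.
rewrite h3 -!mulrDr -(addrA (E j * _)) -!mulrDr h3'.
move: (skew_h i 0) (skew_h i (0 + 2)) => u v.
rewrite -!scalerAr (mulrDr (E i) (E j * _)).
rewrite -scalerBr -scalerDr -scalerBr -(addrC (E i * (E i * _))) opprD !addrA.
by rewrite subrr sub0r [- _ + _]addrC subrK subrr scaler0.
Qed.

(** Only the letter E_j contributes, and moving h_j right past each E_i lowers its index by 2. What
    remains is E_i^3 (h_0 - [3] h_(-2) + [3] h_(-4) - h_(-6)), and two instances of [skew_h3] make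
    it telescope to 0. *)
Lemma comm_serreE_F_off i j : i != j -> comm (serre (E i) (E j)) (F j) = 0.
Proof.
move=> ij; rewrite comm_serre !commMl.
have -> : comm (E i) (F j) = 0 by rewrite skew_EFh (negPf ij).
have -> : comm (E j) (F j) = skew_h j 0 by rewrite skew_EFh eqxx.
have ji : j != i by rewrite eq_sym.
have hx n : skew_h j n * E i = E i * skew_h j (n - 2).
  by rewrite skew_hE cartanN2.
have hxz n (z : A) : skew_h j n * (E i * z) = E i * (skew_h j (n - 2) * z).
  by rewrite mulrA skew_hE cartanN2 // mulrA.
rewrite !(mulr0, mul0r, addr0, add0r) -!mulrA !(hx, hxz).
have h3 := skew_h3 j (0 - 2); have := skew_h3 j (0 - 2 - 2).
rewrite !subrK in h3 * => h3'.
rewrite !scalerAr -h3 -h3'.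
move: (skew_h j 0) (skew_h j _) (skew_h j _) (skew_h j _) => t u v w.
rewrite -!mulrBr -!mulrDr -!mulrBr !addrA addrK !opprD !addrA subrr sub0r.
by rewrite [- _ - _ + _]addrAC addNr add0r addNr !mulr0.
Qed.

(** The exponent is hidden because only membership in a span or vanishing under a linear map is at
    stake, and neither is lost under scaling. *)
Definition qcommute (k x : A) := exists n : int, k * x = q ^ n *: (x * k).

Lemma qcommute_mulr k x y : qcommute k x -> qcommute k y -> qcommute k (x * y).
Proof.
move=> [m xm] [n yn]; exists (m + n); rewrite mulrA xm -scalerAl -(mulrA x k) yn.
by rewrite -scalerAr scalerA mulrA expfzDr.
Qed.

Lemma qcommute_mull k l x : qcommute k x -> qcommute l x -> qcommute (k * l) x.
Proof.
move=> [m xm] [n yn]; exists (m + n); rewrite -(mulrA k l) yn -scalerAr (mulrA k x) xm.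
by rewrite -scalerAl scalerA -(mulrA x k) expfzDr // mulrC.
Qed.

Lemma qcommute1 k : qcommute k 1.
Proof. by exists 0; rewrite expr0z scale1r mul1r mulr1. Qed.

Lemma qcommute1l x : qcommute 1 x.
Proof. by exists 0; rewrite expr0z scale1r mul1r mulr1. Qed.

Lemma qcommute_prod I (h : I -> A) (s : seq I) k :
  (forall i, qcommute k (h i)) -> qcommute k (\prod_(i <- s) h i).
Proof.
move=> H; apply: big_ind => [||i _]; [exact: qcommute1 | | exact: H].
exact: qcommute_mulr.
Qed.

Lemma qcommute_serre k x y : qcommute k x -> qcommute k y ->
  qcommute k (serre x y).
Proof.
move=> [m xm] [n yn].
have qM a b z t : k * z = q ^ a *: (z * k) -> k * t = q ^ b *: (t * k) ->
    k * (z * t) = q ^ (a + b) *: (z * t * k).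
  move=> za tb; rewrite mulrA za -scalerAl -(mulrA z k) tb.
  by rewrite -scalerAr scalerA mulrA expfzDr.
have qC c a b z t : k * z = q ^ a *: (z * k) -> k * t = q ^ b *: (t * k) ->
    k * qcomm c z t = q ^ (a + b) *: (qcomm c z t * k).
  move=> za tb; rewrite /qcomm mulrBr mulrBl -!scalerAr -!scalerAl.
  rewrite (qM _ _ _ _ za tb) (qM _ _ _ _ tb za) scalerBr !scalerA.
  by rewrite (addrC b) ![_ * q ^ _]mulrC.
exists (m + (m + (m + n))); rewrite /serre.
(* The outer commutator is the q-commutator with c = 1, so [qC] handles all three brackets. *)
have commE z t : comm z t = qcomm 1 z t by rewrite /qcomm invr1 !scale1r.
rewrite commE.
exact: (qC _ _ _ _ _ xm (qC _ _ _ _ _ xm (qC _ _ _ _ _ xm yn))).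
Qed.

(** The inverse of [K_i] is the generator [GenKV i], and [Negz m] stands for -(m + 1). *)
Definition Kz i (n : int) : A :=
  match n with Posz m => 'K_i ^+ m | Negz m => 'KV_i ^+ m.+1 end.

Definition Kpow (t : int * int) : A := Kz ord0 t.1 * Kz ord_max t.2.

Lemma K_Kz i n : 'K_i * Kz i n = Kz i (1 + n).
Proof.
case: n => [n|[|n]] /=; rewrite -?exprS //.
  by rewrite expr1 (skew_KKV X_rel).
by rewrite exprS mulrA (skew_KKV X_rel) mul1r subn1.
Qed.

Lemma KV_Kz i n : 'KV_i * Kz i n = Kz i (- 1 + n).
Proof.
case: n => [[|n]|n] /=; rewrite -?exprS // ?mulr1 //.
by rewrite exprS mulrA (skew_KVK X_rel) mul1r ?subn1.
Qed.

Lemma commute_KKz i j n : 'K_i * Kz j n = Kz j n * 'K_i.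
Proof.
have KVK a b : 'KV_a * 'K_b = 'K_b * 'KV_a.
  have := @skew_KVx a 'K_b 0; rewrite oppr0 expr0z !scale1r; apply.
  exact: (skew_KK X_rel).
case: n => n; first exact: (commrX _ (skew_KK X_rel i j)).
exact: (commrX _ (esym (KVK j i))).
Qed.

Lemma commute_KVKz i j n : 'KV_i * Kz j n = Kz j n * 'KV_i.
Proof.
have := @skew_KVx i (Kz j n) 0; rewrite oppr0 expr0z !scale1r; apply.
exact: commute_KKz.
Qed.

Lemma K_Kpow i t : 'K_i * Kpow t = Kpow (unit_wt i + t).
Proof.
case: t => a b; rewrite /Kpow; case: (ord2P i) => ->; rewrite /= ?add0r.
  by rewrite mulrA K_Kz.
by rewrite mulrA commute_KKz -mulrA K_Kz.
Qed.

Lemma KV_Kpow i t : 'KV_i * Kpow t = Kpow (- unit_wt i + t).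
Proof.
case: t => a b; rewrite /Kpow; case: (ord2P i) => ->; rewrite /= ?oppr0 ?add0r.
  by rewrite mulrA KV_Kz.
by rewrite mulrA commute_KVKz -mulrA KV_Kz.
Qed.

Lemma Kz_Kpow i n t : Kz i n * Kpow t = Kpow (unit_wt i *~ n + t).
Proof.
case: n => n /=; rewrite ?NegzE ?mulrNz -!pmulrn.
  by elim: n => [|n IHn]; rewrite ?mul1r ?add0r // exprS mulrS -mulrA IHn K_Kpow addrA.
by elim: n.+1 => [|{}n IHn];
  rewrite ?mul1r ?oppr0 ?add0r // exprS mulrS -mulrA IHn KV_Kpow addrA opprD.
Qed.

Lemma Kpow0 : Kpow 0 = 1. Proof. exact: mulr1. Qed.

Lemma KpowD s t : Kpow s * Kpow t = Kpow (s + t).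
Proof. by rewrite -mulrA !Kz_Kpow addrA unit_wtE. Qed.

(** * Triangular monomials span a subalgebra *)

Definition Ew (w : seq 'I_2) : A := \prod_(j <- w) E j.
Definition Fw (w : seq 'I_2) : A := \prod_(j <- w) F j.

Lemma Ew_cons j w : Ew (j :: w) = E j * Ew w. Proof. exact: big_cons. Qed.
Lemma Fw_cons j w : Fw (j :: w) = F j * Fw w. Proof. exact: big_cons. Qed.

Lemma qcommute_Kpow t x : (forall i, qcommute 'K_i x) -> qcommute (Kpow t) x.
Proof.
move=> Kx; have KVx i : qcommute 'KV_i x.
  by case: (Kx i) => n /skew_KVx e; exists (- n).
have XX (k : A) n : qcommute k x -> qcommute (k ^+ n) x.
  move=> kx; elim: n => [|n IHn]; first exact: qcommute1l.
  by rewrite exprS; apply: qcommute_mull.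
by apply: qcommute_mull; rewrite /Kz; [case: t.1 | case: t.2] => n; apply: XX.
Qed.

Lemma qcommute_KE i j : qcommute 'K_i (E j).
Proof. by exists (cartan i j); apply: (skew_KE X_rel). Qed.
Lemma qcommute_KF i j : qcommute 'K_i (F j).
Proof. by exists (- cartan i j); apply: (skew_KF X_rel). Qed.

Lemma qcommuteVl k x : qcommute k x -> exists n : int, x * k = q ^ n *: (k * x).
Proof.
case=> n kx; exists (- n).
by rewrite kx scalerA -expfzDr // addNr expr0z scale1r.
Qed.

Definition triangular : {pred A} :=
  Defs.span (fun x => exists w t y, x = Ew w * Kpow t * Fw y).

Lemma triangularE w t y : Ew w * Kpow t * Fw y \in triangular.
Proof. by apply: mem_span; exists w, t, y. Qed.

Lemma triangular_mull (a : A) :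
  (forall w t y, a * Ew w * Kpow t * Fw y \in triangular) ->
  forall x, x \in triangular -> a * x \in triangular.
Proof.
move=> H; apply: span_ind => [|c x y xT yT|_ [w [t [y ->]]]].
- by rewrite mulr0 span0.
- by rewrite mulrDr -scalerAr spanD // spanZ.
- by rewrite (mulrA a) (mulrA a (Ew w)) H.
Qed.

Lemma triangular_E j x : x \in triangular -> E j * x \in triangular.
Proof.
apply: triangular_mull => w t y.
by rewrite -Ew_cons triangularE.
Qed.

Lemma triangular_K i x : x \in triangular -> 'K_i * x \in triangular.
Proof.
apply: triangular_mull => w t y.
have [n ->] : qcommute 'K_i (Ew w) by apply/qcommute_prod/qcommute_KE.
by rewrite -!scalerAl -(mulrA _ _ (Kpow t)) K_Kpow spanZ // triangularE.
Qed.

Lemma triangular_KV i x : x \in triangular -> 'KV_i * x \in triangular.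
Proof.
apply: triangular_mull => w t y.
have [n] : qcommute 'K_i (Ew w) by apply/qcommute_prod/qcommute_KE.
move/skew_KVx => ->.
by rewrite -!scalerAl -(mulrA _ _ (Kpow t)) KV_Kpow spanZ // triangularE.
Qed.

(** Induction on [w] through F_j E_i = E_i F_j - [E_i, F_j]: the commutator is 0 or a combination of
    [K_i] and its inverse, under which the span is already stable. For empty [w], F_j crosses K^t up
    to a power of [q]. *)
Lemma triangular_F j x : x \in triangular -> F j * x \in triangular.
Proof.
apply: triangular_mull => w t y.
rewrite -(mulrA _ (Kpow t)) -(mulrA (F j)).
elim: w => [|i w IHw].
  rewrite /Ew big_nil mul1r (mulrA (F j)).
  have [n ->] := qcommuteVl (qcommute_Kpow t (qcommute_KF^~ j)).
  rewrite -scalerAl -mulrA spanZ // -Fw_cons.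
  by have := triangularE [::] t (j :: y); rewrite /Ew big_nil mul1r.
set z := Kpow t * Fw y in IHw *.
have zT : Ew w * z \in triangular by rewrite mulrA triangularE.
have -> : F j * (Ew (i :: w) * z) =
    E i * (F j * (Ew w * z)) - comm (E i) (F j) * (Ew w * z).
  rewrite Ew_cons /comm mulrBl !mulrA opprB addrCA subrr addr0.
  by [].
apply: rpredB; first exact: triangular_E.
rewrite (skew_EF X_rel); case: ifP => _; last by rewrite mul0r span0.
rewrite -scalerAl spanZ // mulrBl; apply: rpredB.
  exact: triangular_K.
exact: triangular_KV.
Qed.

Lemma triangular_gen g x : x \in triangular -> X g * x \in triangular.
Proof.
by case: g => j; [apply: triangular_E | apply: triangular_F |
  apply: triangular_K | apply: triangular_KV].
Qed.

Lemma triangular1 : 1 \in triangular.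
Proof.
by have := triangularE [::] 0 [::]; rewrite /Ew /Fw !big_nil Kpow0 !mulr1.
Qed.

Lemma triangularM x y : x \in triangular -> y \in triangular ->
  x * y \in triangular.
Proof.
move=> + yT; move: x; apply: span_ind => [|c u v uT vT|_ [w [t [w' ->]]]].
- by rewrite mul0r span0.
- by rewrite mulrDl -scalerAl spanD // spanZ.
rewrite -!mulrA.
have wordT (h : 'I_2 -> A) (s : seq 'I_2) z :
    (forall j u, u \in triangular -> h j * u \in triangular) ->
    z \in triangular -> (\prod_(j <- s) h j) * z \in triangular.
  move=> hT zT; elim: s => [|j s IHs]; rewrite ?big_nil ?mul1r //.
  by rewrite big_cons -mulrA hT.
have KzT i n z : z \in triangular -> Kz i n * z \in triangular.
  move=> zT; have XX (k : A) m :
      (forall u, u \in triangular -> k * u \in triangular) ->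
      k ^+ m * z \in triangular.
    by move=> kT; elim: m => [|m IHm]; rewrite ?mul1r // exprS -mulrA kT.
  by case: n => n; apply: XX => u; [apply: triangular_K | apply: triangular_KV].
apply: (wordT) triangular_E _; apply: (KzT); apply: (KzT).
exact: (wordT _ w' y triangular_F yT).
Qed.

(** There are only two nodes, so [k] is [i] or [j] and the two commutator computations cover all
    cases. *)
Lemma serreE_F i j k : i != j ->
  serre (E i) (E j) * F k = F k * serre (E i) (E j).
Proof.
move=> ij; apply/eqP; rewrite -subr_eq0; apply/eqP.
have [->|ki] := eqVneq k i; first exact: comm_serreE_F_diag.
suff -> : k = j by apply: comm_serreE_F_off.
by move: ij ki; case: (ord2P i) (ord2P j) (ord2P k) => -> [] -> [] ->.
Qed.

Lemma Ew_triangular w : Ew w \in triangular.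
Proof.
have := triangularE w 0 [::].
by rewrite Kpow0 /Fw big_nil !mulr1.
Qed.

Lemma Kpow_triangular t : Kpow t \in triangular.
Proof.
by have := triangularE [::] t [::]; rewrite /Fw /Ew !big_nil mulr1 mul1r.
Qed.

Lemma Fw_triangular y : Fw y \in triangular.
Proof.
have := triangularE [::] 0 y.
by rewrite Kpow0 /Ew big_nil !mul1r.
Qed.

Lemma commute_word (h : 'I_2 -> A) S (s : seq 'I_2) :
  (forall j, S * h j = h j * S) ->
  S * (\prod_(j <- s) h j) = (\prod_(j <- s) h j) * S.
Proof.
move=> hS; elim: s => [|j s IHs]; rewrite ?big_nil ?mulr1 ?mul1r //.
by rewrite big_cons mulrA hS -mulrA IHs mulrA.
Qed.

(** * Moving a Serre element into one half *)

Section Sandwich.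
Variables (V : lmodType K) (P : {linear A -> V}) (S : A).
Hypothesis SK : forall i, qcommute 'K_i S.

(** For a = E_w K^t F_y, move [S] left past F_y and re-expand F_y b in triangular monomials E_w'
    K^t' F_y'. Then K^t crosses [S] and E_w', which leaves a multiple of a monomial with [S] inside
    its E-part. *)
Lemma sandwichE : (forall k, S * F k = F k * S) ->
  (forall w w' t y, P (Ew w * S * Ew w' * Kpow t * Fw y) = 0) ->
  forall a b, a \in triangular -> b \in triangular -> P (a * S * b) = 0.
Proof.
move=> SF P0 a b + bT; move: a.
apply: span_ind => [|c u v u0 v0|_ [w [t [y ->]]]].
- by rewrite !mul0r linear0.
- by rewrite mulrDl -scalerAl mulrDl -scalerAl linearP u0 v0 scaler0 addr0.
rewrite -(mulrA _ (Fw y)) -(commute_word y SF) (mulrA _ S) -(mulrA _ (Fw y)).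
move: (Fw y * b) (triangularM (Fw_triangular y) bT).
apply: span_ind => [|c u v u0 v0|_ [w' [t' [y' ->]]]].
- by rewrite !mulr0 linear0.
- by rewrite mulrDr -scalerAr linearP u0 v0 scaler0 addr0.
have [n Sn] := qcommute_Kpow t SK.
have [m wm] : qcommute (Kpow t) (Ew w').
  by apply/qcommute_Kpow => i; apply/qcommute_prod/qcommute_KE.
rewrite -(mulrA (Ew w)) Sn -scalerAr -scalerAl linearZ.
rewrite (mulrA (Ew w)) -(mulrA _ (Kpow t)) (mulrA (Kpow t)) (mulrA (Kpow t)) wm.
rewrite -!scalerAl -scalerAr linearZ -(mulrA _ (Kpow t)) KpowD.
by rewrite 2!(mulrA (Ew w * S)) P0 /= !scaler0.
Qed.

(** The mirror image: [S] moves right past E_w and K^t in [b], and a E_w K^t is re-expanded. Its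
    F-word then stands directly to the left of [S]. *)
Lemma sandwichF : (forall k, S * E k = E k * S) ->
  (forall w t y y', P (Ew w * Kpow t * Fw y * S * Fw y') = 0) ->
  forall a b, a \in triangular -> b \in triangular -> P (a * S * b) = 0.
Proof.
move=> SE P0 a b aT; move: b.
apply: span_ind => [|c u v u0 v0|_ [w [t [y ->]]]].
- by rewrite !mulr0 linear0.
- by rewrite mulrDr -scalerAr linearP u0 v0 scaler0 addr0.
have [n Sn] := qcommuteVl (qcommute_Kpow t SK).
rewrite !(mulrA (a * S)) -!(mulrA a) (commute_word w SE) -(mulrA _ S) Sn.
rewrite -scalerAr -scalerAl -scalerAr linearZ /= !(mulrA a) (mulrA _ (Kpow t)).
move: (_ * Kpow t) (triangularM (triangularM aT (Ew_triangular w)) (Kpow_triangular t)).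
apply: span_ind => [|c u v u0 v0|_ [w' [t' [y' ->]]]].
- by rewrite !mul0r linear0 scaler0.
- rewrite !mulrDl -!scalerAl linearP scalerDr scalerA mulrC -scalerA u0 v0.
  by rewrite scaler0 addr0.
- by rewrite P0 scaler0.
Qed.

End Sandwich.

End Skew.

Section SkewChevalley.
Variables (A : algType K) (X : gen -> A).
Hypotheses (q0 : q != 0) (X_rel : skew_rel X).

(** [serreE_F] applied to the generators exchanged by [chevalley]. *)
Lemma serreF_E i j k : i != j ->
  serre (X (GenF i)) (X (GenF j)) * X (GenE k) =
  X (GenE k) * serre (X (GenF i)) (X (GenF j)).
Proof. exact: (serreE_F q0 (skew_chevalley q0 X_rel)). Qed.

End SkewChevalley.

End SkewRelations.

(** * The action on triples, described by its values on basis vectors *)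

Definition word_wt (i : 'I_2) (w : seq 'I_2) : int := \sum_(j <- w) cartan i j.
(** The exponent of [q] produced when F_j crosses K^t, as [word_wt] is the one produced when [K_i]
    crosses E_w. *)
Definition Kpow_wt (j : 'I_2) (t : int * int) : int :=
  t.1 * cartan ord0 j + t.2 * cartan ord_max j.

Section TriangularAction.
Variables (K : fieldType) (q : K) (A : algType K) (V : lmodType K).
Variables (app : A -> V -> V) (X : gen -> A).
Variable v : seq 'I_2 -> int * int -> seq 'I_2 -> V.
Hypothesis q0 : q != 0.
Hypothesis app1 : forall m, app 1 m = m.
Hypothesis appM : forall a b m, app (a * b) m = app a (app b m).
Hypothesis appB : forall a b m, app (a - b) m = app a m - app b m.
Hypothesis appZl : forall c a m, app (c *: a) m = c *: app a m.
Hypothesis app_linear : forall a, linear (app a).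
Hypothesis app_ext : forall a b,
  (forall w t y, app a (v w t y) = app b (v w t y)) -> a = b.
Hypothesis appE : forall j w t y, app (X (GenE j)) (v w t y) = v (j :: w) t y.
Hypothesis appK : forall i w t y,
  app (X (GenK i)) (v w t y) = q ^ word_wt i w *: v w (unit_wt i + t) y.
Hypothesis appKV : forall i w t y,
  app (X (GenKV i)) (v w t y) = q ^ (- word_wt i w) *: v w (- unit_wt i + t) y.
Hypothesis appF_nil : forall j t y,
  app (X (GenF j)) (v [::] t y) = q ^ Kpow_wt j t *: v [::] t (j :: y).
Hypothesis appF_cons : forall j i w t y, app (X (GenF j)) (v (i :: w) t y) =
  app (X (GenE i)) (app (X (GenF j)) (v w t y)) -
  (if i == j then (q - q^-1)^-1 *:
     (app (X (GenK i)) (v w t y) - app (X (GenKV i)) (v w t y)) else 0).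

Local Notation E j := (X (GenE j)).
Local Notation F j := (X (GenF j)).
Local Notation "'K_ j" := (X (GenK j)) (at level 8, j at level 2).
Local Notation "'KV_ j" := (X (GenKV j)) (at level 8, j at level 2).

Let app0 a : app a 0 = 0.
Proof.
by have := app_linear a (-1) 0 0; rewrite scaler0 addr0 scaleN1r addNr.
Qed.
Let appZ c a m : app a (c *: m) = c *: app a m.
Proof. by have := app_linear a c m 0; rewrite addr0 app0 addr0. Qed.

Let wt_cons i j w : word_wt i (j :: w) = cartan i j + word_wt i w.
Proof. exact: big_cons. Qed.

Let act_KE i j : 'K_i * E j = q ^ cartan i j *: (E j * 'K_i).
Proof.
apply: app_ext => w t y; rewrite appZl !appM appE !appK appZ appE scalerA.
by rewrite wt_cons expfzDr.
Qed.

Let act_KK i j : 'K_i * 'K_j = 'K_j * 'K_i.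
Proof.
apply: app_ext => w t y; rewrite !appM !appK !appZ !appK !scalerA mulrC.
by rewrite addrCA.
Qed.

Let act_KKV i : 'K_i * 'KV_i = 1.
Proof.
apply: app_ext => w t y; rewrite appM appKV appZ appK scalerA -expfzDr //.
by rewrite addNr expr0z scale1r addrA subrr add0r app1.
Qed.

Let act_KVK i : 'KV_i * 'K_i = 1.
Proof.
apply: app_ext => w t y; rewrite appM appK appZ appKV scalerA -expfzDr //.
by rewrite subrr expr0z scale1r addrA addNr add0r app1.
Qed.

(** True by construction: [appF_cons] subtracts exactly this commutator when F_j meets the first
    letter of a word. *)
Let act_EF i j :
  comm (E i) (F j) = if i == j then (q - q^-1)^-1 *: ('K_i - 'KV_i) else 0.
Proof.
apply: app_ext => w t y; rewrite appB !appM appE appF_cons opprB addrCA subrr.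
rewrite addr0; case: ifP => // _; first by rewrite appZl appB.
by have := appZl 0 0 (v w t y); rewrite !scale0r.
Qed.

Let K_KV i j : 'K_i * 'KV_j = 'KV_j * 'K_i.
Proof.
rewrite -[LHS]mul1r -(act_KVK j) -mulrA (mulrA _ 'K_i).
by rewrite (act_KK j) -(mulrA 'K_i) act_KKV mulr1.
Qed.

(* The difference of the two sides q-commutes with every E_k, so it vanishes by
   induction on the word w. *)
Let act_KF i j : 'K_i * F j = q ^ (- cartan i j) *: (F j * 'K_i).
Proof.
pose D := 'K_i * F j - q ^ (- cartan i j) *: (F j * 'K_i).
have DE k : D * E k = q ^ cartan i k *: (E k * D).
  have FE : F j * E k = E k * F j - comm (E k) (F j).
    by rewrite /comm opprB addrCA subrr addr0.
  (* Both sides are 0 unless k = j. In that case the powers of [q] cancel, and the commutator is a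
     combination of [K_j] and its inverse, which commute with [K_i]. *)
  have hK : q ^ cartan i k *: (q ^ (- cartan i j) *: (comm (E k) (F j) * 'K_i))
      = 'K_i * comm (E k) (F j).
    rewrite act_EF; case: eqP => [->|_]; last by rewrite mul0r mulr0 !scaler0.
    rewrite scalerA -expfzDr // subrr expr0z scale1r -scalerAl -scalerAr.
    by rewrite mulrBl mulrBr act_KK K_KV.
  rewrite /D mulrBl -(mulrA 'K_i) -scalerAl -(mulrA (F j)) act_KE FE.
  rewrite -scalerAr (mulrA (F j)) FE mulrBr mulrBl mulrA act_KE.
  rewrite !scalerBr -hK -scalerAl -(mulrA (E k)) -(mulrA (E k)).
  rewrite [in RHS]mulrBr -scalerAr scalerBr !scalerA.
  rewrite [q ^ (- cartan i j) * _]mulrC opprB addrA subrK.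
  by [].
suff: D = 0 by move/eqP; rewrite subr_eq0 => /eqP.
have app0l m : app 0 m = 0 by have := appZl 0 0 m; rewrite !scale0r.
apply: app_ext => w t y; rewrite app0l; elim: w => [|k w IHw].
  rewrite appB appZl !appM appF_nil appK appZ appK appZ appF_nil !scalerA.
  have -> : Kpow_wt j (unit_wt i + t) = cartan i j + Kpow_wt j t.
    rewrite /Kpow_wt /= !mulrDl addrACA; congr (_ + _).
    by case: (ord2P i) => ->; rewrite /= !(mul0r, mul1r, addr0, add0r).
  rewrite /word_wt big_nil !expr0z !mulr1 -expfzDr // addrA addNr add0r.
  by rewrite subrr.
by rewrite -appE -appM DE appZl appM IHw app0 scaler0.
Qed.

Lemma skew_rel_action : skew_rel q X.
Proof. by split. Qed.

Lemma app_Kpow t y : app (Kpow X t) (v [::] 0 y) = v [::] t y.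
Proof.
have appK0 i s : app 'K_i (v [::] s y) = v [::] (unit_wt i + s) y.
  by rewrite appK /word_wt big_nil expr0z scale1r.
have appKV0 i s : app 'KV_i (v [::] s y) = v [::] (- unit_wt i + s) y.
  by rewrite appKV /word_wt big_nil oppr0 expr0z scale1r.
have appKz i n s : app (Kz X i n) (v [::] s y) = v [::] (unit_wt i *~ n + s) y.
  case: n => n; rewrite /Kz ?NegzE ?mulrNz -!pmulrn.
    elim: n => [|n IHn]; first by rewrite app1 add0r.
    by rewrite exprS mulrS appM IHn appK0 addrA.
  elim: n.+1 => [|{}n IHn]; first by rewrite app1 oppr0 add0r.
  by rewrite exprS mulrS appM IHn appKV0 addrA opprD.
by rewrite /Kpow appM !appKz addr0 unit_wtE.
Qed.

(** F_y acts at t = 0 and K^t acts on the empty word. Both weights vanish there, so no power of [q]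
    appears. *)
Lemma app_triangular w t y :
  app (Ew X w * Kpow X t * Fw X y) (v [::] 0 [::]) = v w t y.
Proof.
rewrite 2!appM.
have -> : app (Fw X y) (v [::] 0 [::]) = v [::] 0 y.
  elim: y => [|j y IHy]; first by rewrite /Fw big_nil app1.
  rewrite Fw_cons appM IHy appF_nil /Kpow_wt !mul0r addr0 expr0z.
  by rewrite scale1r.
rewrite app_Kpow; elim: w => [|j w IHw]; first by rewrite /Ew big_nil app1.
by rewrite Ew_cons appM IHw appE.
Qed.


End TriangularAction.

(** * The module of triples and freeness of the triangular monomials *)

Section TriangularModule.
Variables (K : fieldType) (q : K).
Hypothesis q0 : q != 0.

Let B : choiceType := (seq 'I_2 * (int * int) * seq 'I_2)%type.
Let vac : B := ([::], 0, [::]).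
Local Notation M := {malg K[B]}.
Local Notation A := (malg_end K vac).

Definition tri_basis (w : seq 'I_2) (t : int * int) (y : seq 'I_2) : M :=
  << (w, t, y) >>.
Definition actE (j : 'I_2) (b : B) : M := tri_basis (j :: b.1.1) b.1.2 b.2.
Definition actK (i : 'I_2) (b : B) : M :=
  q ^ word_wt i b.1.1 *: tri_basis b.1.1 (unit_wt i + b.1.2) b.2.
Definition actKV (i : 'I_2) (b : B) : M :=
  q ^ (- word_wt i b.1.1) *: tri_basis b.1.1 (- unit_wt i + b.1.2) b.2.

(* F_j E_i = E_i F_j - [E_i, F_j] moves F_j past the letters of the word w. *)
Fixpoint actF_word (j : 'I_2) (w : seq 'I_2) (t : int * int) (y : seq 'I_2) : M :=
  if w is i :: w' then
    malg_lift (actE i) (actF_word j w' t y) -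
    (if i == j then (q - q^-1)^-1 *: (actK i (w', t, y) - actKV i (w', t, y))
     else 0)
  else q ^ Kpow_wt j t *: tri_basis [::] t (j :: y).
Definition actF (j : 'I_2) (b : B) : M := actF_word j b.1.1 b.1.2 b.2.

Definition act_gen (g : gen) : A :=
  match g with
  | GenE j => malg_end_of vac (actE j) | GenF j => malg_end_of vac (actF j)
  | GenK j => malg_end_of vac (actK j) | GenKV j => malg_end_of vac (actKV j)
  end.

(** Evaluation of operators at the vector [([::], 0, [::])] is linear and sends the triangular
    monomials to the basis, on which any linear map can be prescribed. *)
Lemma triangular_free : exists (A : algType K) (X : gen -> A), skew_rel q X /\
  forall (V : lmodType K) (f : seq 'I_2 -> int * int -> seq 'I_2 -> V),
    exists P : {linear A -> V},
      forall w t y, P (Ew X w * Kpow X t * Fw X y) = f w t y.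
Proof.
pose app (a : A) (m : M) : M := lin_end_fun a m.
pose X := act_gen; pose v := tri_basis; pose aF := actF_word.
have app1 m : app 1 m = m by [].
have appM a b m : app (a * b) m = app a (app b m) by [].
have appB a b m : app (a - b) m = app a m - app b m by [].
have appZl c a m : app (c *: a) m = c *: app a m by [].
have app_linear a : linear (app a) by apply: linearP.
have app_linl m : linear (app^~ m) by [].
have app_ext a b : (forall w t y, app a (v w t y) = app b (v w t y)) -> a = b.
  by move=> ab; apply: malg_end_ext => -[[w t] y]; apply: ab.
have appE j w t y : app (X (GenE j)) (v w t y) = v (j :: w) t y.
  exact: malg_end_ofE.
have appK i w t y : app (X (GenK i)) (v w t y) =
    q ^ word_wt i w *: v w (unit_wt i + t) y by exact: malg_end_ofE.
have appKV i w t y : app (X (GenKV i)) (v w t y) =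
    q ^ (- word_wt i w) *: v w (- unit_wt i + t) y by exact: malg_end_ofE.
have appF j w t y : app (X (GenF j)) (v w t y) = aF j w t y.
  exact: malg_end_ofE.
have aF_nil j t y : aF j [::] t y = q ^ Kpow_wt j t *: v [::] t (j :: y) by [].
have aF_cons j i w t y : aF j (i :: w) t y = app (X (GenE i)) (aF j w t y) -
    (if i == j then (q - q^-1)^-1 *: (q ^ word_wt i w *: v w (unit_wt i + t) y -
       q ^ (- word_wt i w) *: v w (- unit_wt i + t) y) else 0) by [].
have v_free (V : lmodType K) (f : seq 'I_2 -> int * int -> seq 'I_2 -> V) :
    exists g : {linear M -> V}, forall w t y, g (v w t y) = f w t y.
  exists (malg_lift (fun b : B => f b.1.1 b.1.2 b.2)) => w t y.
  exact: malg_lift_basis.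
(* Unfolding these bodies makes the unifier diverge on failing matches. *)
clearbody app X v aF; exists A, X.
have appF_nil j t y :
    app (X (GenF j)) (v [::] t y) = q ^ Kpow_wt j t *: v [::] t (j :: y).
  by rewrite appF.
have appF_cons j i w t y : app (X (GenF j)) (v (i :: w) t y) =
    app (X (GenE i)) (app (X (GenF j)) (v w t y)) -
    (if i == j then (q - q^-1)^-1 *: (app (X (GenK i)) (v w t y) -
       app (X (GenKV i)) (v w t y)) else 0).
  by rewrite !appF aF_cons appK appKV.
split; first exact: (skew_rel_action q0 app1 appM appB appZl app_linear app_ext
  appE appK appKV appF_nil appF_cons).
move=> V f; have [g gv] := v_free V f.
pose P a := g (app a (v [::] 0 [::])).
have Plin : linear P by move=> c a b; rewrite /P app_linl linearP.
pose P' := GRing.isLinear.Build _ _ _ _ P Plin.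
exists (HB.pack P P' : {linear A -> V}) => w t y /=.
by rewrite /P (app_triangular app1 appM appE appK appKV appF_nil) gv.
Qed.

End TriangularModule.

(** * Evaluation of noncommutative polynomials, and algebra morphisms *)

Section AlgebraEvaluation.
Variables (K : fieldType) (I : choiceType) (A : algType K) (h : I -> A).

Definition alg_eval (x : free_alg K I) : A := free_eval (in_alg A) h x.

Lemma alg_eval_zmod : zmod_morphism alg_eval.
Proof. exact: free_eval_zmod. Qed.
Lemma alg_eval_monoid : monoid_morphism alg_eval.
Proof.
split; first exact: free_eval1.
by apply: free_evalM => a s; rewrite /GRing.comm /= mulr_algl mulr_algr.
Qed.
Lemma alg_eval_scalable : scalable alg_eval.
Proof. by move=> a x; rewrite /alg_eval free_evalZ /= mulr_algl. Qed.
HB.instance Definition _ :=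
  GRing.isZmodMorphism.Build (free_alg K I) A alg_eval alg_eval_zmod.
HB.instance Definition _ :=
  GRing.isMonoidMorphism.Build (free_alg K I) A alg_eval alg_eval_monoid.
HB.instance Definition _ :=
  GRing.isScalable.Build K (free_alg K I) A *:%R alg_eval alg_eval_scalable.

Lemma alg_eval_gen i : alg_eval (free_gen K i) = h i.
Proof. exact: free_eval_gen. Qed.

Lemma alg_eval_word (w : {fmonom I}) :
  alg_eval (<< w >> : {malg K[{fmonom I}]}) = \prod_(i <- (w : seq I)) h i.
Proof. by rewrite /alg_eval /free_eval mmapU /= scale1r mul1r. Qed.

Lemma free_alg_ind (P : free_alg K I -> Prop) : P 0 ->
  (forall a x y, P x -> P y -> P (a *: x + y)) ->
  (forall w : {fmonom I}, P (<< w >> : {malg K[{fmonom I}]})) -> forall x, P x.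
Proof. exact: malg_ind. Qed.

Lemma subalg_alg_eval x : x \in subalg (fun y => exists i, y = h i) ->
  exists u, x = alg_eval u.
Proof.
move/subalgP/(_ (fun y => `[< exists u, y = alg_eval u >])) => H.
apply/asboolP/H => [|y [i ->]]; last first.
  by apply/asboolP; exists (free_gen K i); rewrite alg_eval_gen.
split=> [|a y z /asboolP [u ->] /asboolP [v ->]|
  y z /asboolP [u ->] /asboolP [v ->]]; apply/asboolP.
- by exists 1; rewrite rmorph1.
- by exists (a *: u + v); rewrite linearP.
- by exists (u * v); rewrite rmorphM.
Qed.

End AlgebraEvaluation.

Section Morphisms.
Variables (K : fieldType) (q : K) (A B : algType K) (f : {lrmorphism A -> B}).

Lemma rmorph_comm x y : f (comm x y) = comm (f x) (f y).
Proof. by rewrite /comm rmorphB !rmorphM. Qed.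

Lemma rmorph_qcomm c x y : f (qcomm c x y) = qcomm c (f x) (f y).
Proof. by rewrite /qcomm raddfB /= !linearZ_LR !rmorphM. Qed.

Lemma rmorph_serre x y : f (serre q x y) = serre q (f x) (f y).
Proof. by rewrite /serre rmorph_comm !rmorph_qcomm. Qed.

Lemma alg_eval_morph (I : choiceType) (h : I -> A) x :
  f (alg_eval h x) = alg_eval (f \o h) x.
Proof.
move: x; apply: free_alg_ind => [|a x y xE yE|w]; first by rewrite !linear0.
  by rewrite [alg_eval h _]linearP [LHS]linearP [RHS]linearP /= xE yE.
by rewrite !alg_eval_word rmorph_prod.
Qed.

Variable X : gen -> A.

Lemma rmorph_Ew w : f (Ew X w) = Ew (f \o X) w.
Proof. exact: rmorph_prod. Qed.
Lemma rmorph_Fw w : f (Fw X w) = Fw (f \o X) w.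
Proof. exact: rmorph_prod. Qed.
Lemma rmorph_Kpow t : f (Kpow X t) = Kpow (f \o X) t.
Proof.
rewrite /Kpow rmorphM.
by congr (_ * _); rewrite /Kz; [case: t.1 | case: t.2] => n; rewrite rmorphXn.
Qed.

Lemma DJ_rel_map l r : DJ_rel q X l r -> DJ_rel q (f \o X) (f l) (f r).
Proof.
case=> [i j|i|i|i j|i j|i j|i j ij|i j ij].
- by rewrite !rmorphM; apply: (rel_KK q (f \o X)).
- by rewrite rmorphM rmorph1; apply: (rel_KKV q (f \o X)).
- by rewrite rmorphM rmorph1; apply: (rel_KVK q (f \o X)).
- by rewrite linearZ_LR !rmorphM; apply: (rel_KE q (f \o X)).
- by rewrite linearZ_LR !rmorphM; apply: (rel_KF q (f \o X)).
- rewrite rmorph_comm (fun_if f) linear0 linearZ_LR raddfB /=.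
  exact: (rel_EF q (f \o X)).
- rewrite rmorph_comm !rmorph_qcomm linear0.
  exact: (rel_serreE q (f \o X) ij).
- rewrite rmorph_comm !rmorph_qcomm linear0.
  exact: (rel_serreF q (f \o X) ij).
Qed.

End Morphisms.

(** Leaves only the Serre relators to be killed by a functional. *)
Lemma skew_DJ_cases (K : fieldType) (q : K) (A : algType K) (X : gen -> A) l r :
  skew_rel q X -> DJ_rel q X l r -> l = r \/
  exists i j, [/\ i != j, r = 0 &
    l = serre q (X (GenE i)) (X (GenE j)) \/
    l = serre q (X (GenF i)) (X (GenF j))].
Proof.
move=> H [i j|i|i|i j|i j|i j|i j ij|i j ij].
- by left; apply: skew_KK H _ _.
- by left; apply: skew_KKV H _.
- by left; apply: skew_KVK H _.
- by left; rewrite (skew_KE H) -scalerAl -mulrA (skew_KKV H) mulr1.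
- by left; rewrite (skew_KF H) -scalerAl -mulrA (skew_KKV H) mulr1.
- by left; apply: skew_EF H _ _.
- by right; exists i, j; split=> //; left.
- by right; exists i, j; split=> //; right.
Qed.

(** * Alternating generators and the subalgebras of the E_j and the F_j *)

Section SeriesSubalgebra.
Variables (K : fieldType) (A : algType K) (G : A -> Prop).
Local Notation S := (subalg G).

Lemma subalg_seriesM f g : (forall n, f n \in S) -> (forall n, g n \in S) ->
  forall n, seriesM f g n \in S.
Proof. by move=> fS gS n; apply: rpred_sum => i _; apply: rpredM. Qed.

Lemma subalg_series_exp f : (forall n, f n \in S) ->
  forall n, series_exp f n \in S.
Proof.
move=> fS n; apply: rpred_sum => i _; apply: rpredZ.
move: (i : nat) => {i}m; elim: m n => [|m IHm] n; last exact: subalg_seriesM.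
by rewrite /seriesX /= /series1; case: (n == 0%N); rewrite ?rpred1 ?rpred0.
Qed.

Lemma subalg_series_log g : (forall n, g n \in S) ->
  forall n, series_log g n \in S.
Proof.
move=> gS n; suff H m k : series_log_upto g m k \in S by apply: H.
elim: m k => [|m IHm] k /=; first exact: rpred0.
by case: ifP => // _; rewrite rpredB // subalg_series_exp.
Qed.

Lemma subalg_comm x y : x \in S -> y \in S -> comm x y \in S.
Proof. by move=> xS yS; rewrite rpredB ?rpredM. Qed.

End SeriesSubalgebra.

Section Halves.
Variables (K : fieldType) (q : K).
Local Notation U := (Uq q).

Definition E_gens (x : U) : Prop := exists j, x = Uq_gen q (GenE j).
Definition F_gens (x : U) : Prop := exists j, x = Uq_gen q (GenF j).

Lemma E_gen_mem j : Uq_gen q (GenE j) \in subalg E_gens.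
Proof. by apply: mem_subalg; exists j. Qed.

(** Each coefficient of a product, exponential or logarithm of series is a finite polynomial
    expression in coefficients of the given series, so every stage of the definition stays in the
    subalgebra. *)
Lemma right_alternating_E x : right_alternating x -> x \in subalg E_gens.
Proof.
have eS j := E_gen_mem j.
have dS : E_delta q \in subalg E_gens.
  by apply: rpredB; [| apply: rpredZ]; apply: rpredM; apply: eS.
have a1S k : E_alpha1 q k \in subalg E_gens.
  elim: k => [|k IHk]; first exact: eS.
  by apply: rpredZ; apply: subalg_comm.
have a0S k : E_alpha0 q k \in subalg E_gens.
  elim: k => [|k IHk]; first exact: eS.
  by apply: rpredZ; apply: subalg_comm.
have psiS k : psi_series q k \in subalg E_gens.
  rewrite /psi_series; case: ifP => _; first exact: rpred1.
  apply: rpredZ; apply: rpredB; first by apply: rpredM; [apply: a0S | apply: eS].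
  by apply: rpredZ; apply: rpredM; [apply: eS | apply: a0S].
have XS n : X_series q n \in subalg E_gens.
  apply: subalg_series_exp => k; apply: rpredZ; apply: rpredZ.
  exact: subalg_series_log.
have as1S n : alpha1_series q n \in subalg E_gens.
  by case: n => [|n]; [apply: rpred0 | apply: rpredZ; apply: a1S].
have as0S n : alpha0_series q n \in subalg E_gens.
  by case: n => [|n]; [apply: rpred0 | apply: rpredZ; apply: a0S].
have WnS k : W_neg q k \in subalg E_gens.
  by apply: rpredZ; apply: rpredZ; apply: (subalg_seriesM XS as1S).
have WpS k : W_pos q k \in subalg E_gens.
  by apply: rpredZ; apply: rpredZ; apply: (subalg_seriesM as0S XS).
have GS k : G_alt q k \in subalg E_gens.
  apply: rpredZ; apply: rpredZ; apply: rpredB; first exact: XS.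
  by rewrite /series1; case: (_ == _); [apply: rpred1 | apply: rpred0].
have GtS k : Gt_alt q k \in subalg E_gens.
  apply: rpredD (GS k) _; apply: rpredZ.
  exact: subalg_comm (WnS 0%N) (WpS k).
by case=> k [] ->; [apply: WnS | apply: WpS | apply: GS | apply: GtS].
Qed.

Hypotheses (q0 : q != 0) (q1 : q + q^-1 != 0).

(** At index 0, [W_pos] gives E_0 and [W_neg] gives E_1. *)
Lemma E_gen_right j : right_alternating (Uq_gen q (GenE j)).
Proof.
exists 0%N; case: (ord2P j) => ->.
  by apply: Or42; rewrite W_pos0.
by apply: Or41; rewrite W_neg0.
Qed.

Variable qbar : {rmorphism K -> K}.
Hypothesis qbar_q : qbar q = q^-1.

(** [Omega] is a semilinear antimorphism, so the preimage of a subalgebra is a subalgebra; this one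
    contains the E_j. *)
Lemma left_alternating_F x : left_alternating qbar x -> x \in subalg F_gens.
Proof.
case=> y /right_alternating_E yE ->{x}.
pose P : {pred U} := fun u => Omega qbar u \in subalg F_gens.
have PE u : (u \in P) = (Omega qbar u \in subalg F_gens) by [].
rewrite -PE; move: yE => /subalgP; apply.
  split=> [|a u v|u v]; rewrite !PE.
  - by rewrite (Omega1 q0 qbar_q); apply: rpred1.
  - move=> uS vS; have OB := Omega_zmod q0 qbar_q.
    have O0 : Omega qbar 0 = 0 :> U by rewrite -[X in Omega _ X](subrr 0) OB subrr.
    rewrite -[v]opprK -[- v]sub0r !OB (OmegaZ q0 qbar_q) O0 sub0r opprK.
    by apply: rpredD; [apply: rpredZ; apply: uS | apply: vS].
  - move=> uS vS; rewrite (OmegaM q0 qbar_q).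
    by apply: rpredM; [apply: vS | apply: uS].
move=> _ [j ->]; rewrite PE (Omega_genE q0 qbar_q).
by apply: mem_subalg; exists j.
Qed.

Lemma F_gen_left j : left_alternating qbar (Uq_gen q (GenF j)).
Proof.
by exists (Uq_gen q (GenE j)); [apply: E_gen_right | rewrite Omega_genE].
Qed.

End Halves.

Lemma triangular_alg_eval (K : fieldType) (q : K) (A : algType K)
  (X : gen -> A) x : q != 0 -> skew_rel q X -> alg_eval X x \in triangular X.
Proof.
move=> q0 X_rel; move: x; apply: free_alg_ind => [|a x y xT yT|w].
- by rewrite linear0 span0.
- by rewrite linearP spanD // spanZ.
rewrite alg_eval_word; elim: (w : seq gen) => [|g s IHs].
  by rewrite big_nil triangular1.
by rewrite big_cons (triangular_gen q0 X_rel).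
Qed.

(** * Descent of the functional to the quantum group *)

Section UqFunctional.
Variables (K : fieldType) (q : K) (AR AL : algType K).
Variables (eR : 'I_2 -> AR) (eL : 'I_2 -> AL) (V : lmodType K).
Variable g : AR -> int * int -> AL -> V.
Hypothesis q0 : q != 0.
Hypothesis serreR : forall i j, i != j -> serre q (eR i) (eR j) = 0.
Hypothesis serreL : forall i j, i != j -> serre q (eL i) (eL j) = 0.
Hypothesis g_linl : forall t b, linear (fun a => g a t b).
Hypothesis g_linr : forall a t, linear (g a t).

Let g0l t b : g 0 t b = 0.
Proof.
by have := g_linl t b (-1) 0 0; rewrite scaler0 addr0 scaleN1r addNr.
Qed.
Let g0r a t : g a t 0 = 0.
Proof.
by have := g_linr a t (-1) 0 0; rewrite scaler0 addr0 scaleN1r addNr.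
Qed.

Section Functional.
Variables (A : algType K) (X : gen -> A) (P : {linear A -> V}).
Hypothesis X_rel : skew_rel q X.
Hypothesis PE : forall w t y, P (Ew X w * Kpow X t * Fw X y) =
  g (\prod_(j <- w) eR j) t (\prod_(j <- y) eL j).

Local Notation XE := (fun j => X (GenE j)).
Local Notation XF := (fun j => X (GenF j)).

Let P_free x t y : P (alg_eval XE x * Kpow X t * alg_eval XF y) =
  g (alg_eval eR x) t (alg_eval eL y).
Proof.
move: x; apply: free_alg_ind => [|a u v uE vE|w].
- by rewrite !linear0 !mul0r g0l linear0.
- by rewrite !linearP !mulrDl -!scalerAl linearP uE vE g_linl.
rewrite !alg_eval_word; move: y; apply: free_alg_ind => [|a u v uE vE|y].
- by rewrite !linear0 mulr0 g0r linear0.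
- by rewrite !linearP !mulrDr -!scalerAr linearP uE vE g_linr.
by rewrite !alg_eval_word -PE.
Qed.

Let wordE (w : seq 'I_2) : exists x : free_alg K 'I_2, Ew X w = alg_eval XE x.
Proof.
by exists (<< FMonom w >> : {malg K[{fmonom 'I_2}]}); rewrite alg_eval_word.
Qed.
Let wordF (w : seq 'I_2) : exists x : free_alg K 'I_2, Fw X w = alg_eval XF x.
Proof.
by exists (<< FMonom w >> : {malg K[{fmonom 'I_2}]}); rewrite alg_eval_word.
Qed.

(** The other relators are already 0 in [A]. A Serre relator is moved into the E-part or the F-part
    by the sandwich lemmas; there [P_free] turns it into a Serre element of [AR] or [AL], which is
    0. *)
Lemma functional_DJ l r a b : DJ_rel q X l r ->
  a \in triangular X -> b \in triangular X -> P (a * (l - r) * b) = 0.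
Proof.
move=> /(skew_DJ_cases X_rel) [->|[i [j [ij -> [->|->]]]]] aT bT.
- by rewrite subrr mulr0 mul0r linear0.
- rewrite subr0; apply: (sandwichE q0 X_rel) aT bT => [k|k|w w' t y].
  + by apply: (qcommute_serre q0); apply: (qcommute_KE X_rel).
  + exact: (serreE_F q0 X_rel).
  + have [u ->] := wordE w; have [u' ->] := wordE w'; have [z ->] := wordF y.
    rewrite -(alg_eval_gen XE i) -(alg_eval_gen XE j) -rmorph_serre -!rmorphM.
    rewrite P_free !rmorphM /= rmorph_serre /= !alg_eval_gen serreR //.
    by rewrite mulr0 mul0r g0l.
- rewrite subr0; apply: (sandwichF q0 X_rel) aT bT => [k|k|w t y y'].
  + by apply: (qcommute_serre q0); apply: (qcommute_KF X_rel).
  + exact: (serreF_E q0 X_rel).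
  + have [u ->] := wordE w; have [z ->] := wordF y; have [z' ->] := wordF y'.
    rewrite -(alg_eval_gen XF i) -(alg_eval_gen XF j) -rmorph_serre.
    rewrite -!(mulrA (_ * Kpow X t)) -!rmorphM.
    rewrite P_free !rmorphM /= rmorph_serre /= !alg_eval_gen serreL //.
    by rewrite mulr0 mul0r g0r.
Qed.

End Functional.

Local Notation Xq := (Uq_gen q).

(** Evaluate a polynomial in [A] and apply the functional given by freeness. It kills the ideal of
    relations by [functional_DJ], since all values of polynomials are triangular, and so depends
    only on the class in [Uq q]. *)
Lemma Uq_functional : exists P : {linear Uq q -> V}, forall w t y,
  P (Ew Xq w * Kpow Xq t * Fw Xq y) =
  g (\prod_(j <- w) eR j) t (\prod_(j <- y) eL j).
Proof.
have [A [X [X_rel free]]] := triangular_free q0.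
have [P PE] := free V (fun w t y => g (\prod_(j <- w) eR j) t (\prod_(j <- y) eL j)).
pose ev (x : free_alg K gen) : V := P (alg_eval X x).
have evB x y : ev (x - y) = ev x - ev y by rewrite /ev !linearB.
have ev_lin : linear ev by move=> a x y; rewrite /ev !linearP.
have genX : alg_eval X \o free_gen K (I := gen) = X.
  by apply/funext => h /=; apply: alg_eval_gen.
have ev_eq x y : Uq_pi q x = Uq_pi q y -> ev x = ev y.
  move/quotalg_piE => xy; apply/eqP; rewrite -subr_eq0 -evB; apply/eqP.
  move: (x - y) xy; apply: span_ind => [|a u v u0 v0|_ [b [c [l [r [lr ->]]]]]].
  - by rewrite /ev !linear0.
  - by rewrite ev_lin u0 v0 scaler0 addr0.
  - rewrite /ev !rmorphM rmorphB.
    have := DJ_rel_map (alg_eval X) lr; rewrite genX => lr'.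
    by apply: (functional_DJ X_rel PE lr'); apply: (triangular_alg_eval _ q0 X_rel).
pose f (u : Uq q) : V := ev (repr u).
have f_pi x : f (Uq_pi q x) = ev x by apply: ev_eq; apply: quotmod_reprK.
have f_lin : linear f.
  move=> a; elim/Uq_ind=> x; elim/Uq_ind=> y.
  by rewrite -linearP !f_pi ev_lin.
pose f' := GRing.isLinear.Build _ _ _ _ f f_lin.
exists (HB.pack f f' : {linear Uq q -> V}) => w t y /=.
have -> : Ew Xq w * Kpow Xq t * Fw Xq y = Uq_pi q (Ew (free_gen K (I := gen)) w *
    Kpow (free_gen K (I := gen)) t * Fw (free_gen K (I := gen)) y).
  by rewrite 2!rmorphM /= rmorph_Ew rmorph_Kpow rmorph_Fw.
rewrite f_pi /ev 2!rmorphM /= rmorph_Ew rmorph_Kpow rmorph_Fw genX.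
exact: PE.
Qed.

End UqFunctional.

(** * A criterion for the multiplication map to be bijective *)

Section MultiplicationIso.
Variables (K : fieldType) (U : algType K) (AR A0 AL : lmodType K).
Variables (iR : {linear AR -> U}) (i0 : {linear A0 -> U}) (iL : {linear AL -> U}).
Variables (IR I0 IL : Type) (r : IR -> AR) (k : I0 -> A0) (l : IL -> AL).
Local Notation W := (tensor (tensor AR A0) AL).
Variable P : {linear U -> W}.
Hypothesis spanR : forall a, a \in Defs.span (fun x => exists i, x = r i).
Hypothesis spanC : forall a, a \in Defs.span (fun x => exists i, x = k i).
Hypothesis spanL : forall a, a \in Defs.span (fun x => exists i, x = l i).
Hypothesis spanU : forall u, u \in Defs.span (fun x => exists a b c,
  x = iR (r a) * i0 (k b) * iL (l c)).
Hypothesis PE : forall a b c, P (iR (r a) * i0 (k b) * iL (l c)) =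
  pure_tensor (pure_tensor (r a) (k b)) (l c).

Let pure0l (V V' : lmodType K) (w : V') : pure_tensor (0 : V) w = 0.
Proof. by rewrite -(scale0r 0) pure_tensorZl scale0r. Qed.
Let pure0r (V V' : lmodType K) (v : V) : pure_tensor v (0 : V') = 0.
Proof. by rewrite -(scale0r 0) pure_tensorZr scale0r. Qed.

Let P_pure a b c : P (iR a * i0 b * iL c) = pure_tensor (pure_tensor a b) c.
Proof.
move: a (spanR a); apply: span_ind => [|s a a' aE a'E|_ [i ->]].
- by rewrite linear0 !mul0r linear0 !pure0l.
- rewrite linearP !mulrDl -!scalerAl linearP aE a'E.
  by rewrite pure_tensorDl pure_tensorZl pure_tensorDl pure_tensorZl.
move: b (spanC b); apply: span_ind => [|s b b' bE b'E|_ [j ->]].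
- by rewrite linear0 mulr0 mul0r linear0 pure0r pure0l.
- rewrite linearP mulrDr -scalerAr mulrDl -scalerAl linearP bE b'E.
  by rewrite pure_tensorDr pure_tensorZr pure_tensorDl pure_tensorZl.
move: c (spanL c); apply: span_ind => [|s c c' cE c'E|_ [m ->]].
- by rewrite linear0 mulr0 linear0 pure0r.
- rewrite linearP mulrDr -scalerAr linearP cE c'E.
  by rewrite pure_tensorDr pure_tensorZr.
exact: PE.
Qed.

(** [P] is a two-sided inverse: one composite is the identity on pure tensors by [P_pure], the other
    on the spanning monomials of [U]. *)
Lemma multiplication_iso : exists mult : {linear W -> U}, bijective mult /\
  forall a b c, mult (pure_tensor (pure_tensor a b) c) = iR a * i0 b * iL c.
Proof.
have m1l b : linear (fun a => iR a * i0 b).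
  by move=> s x y; rewrite linearP mulrDl -scalerAl.
have m1r a : linear (fun b => iR a * i0 b).
  by move=> s x y; rewrite linearP mulrDr -scalerAr.
have [m1 m1E _] := tensor_lift m1l m1r.
have ml c : linear (fun t : tensor AR A0 => m1 t * iL c).
  by move=> s x y; rewrite linearP mulrDl -scalerAl.
have mr t : linear (fun c => m1 t * iL c).
  by move=> s x y; rewrite linearP mulrDr -scalerAr.
have [mult multE _] := tensor_lift ml mr.
have mE a b c : mult (pure_tensor (pure_tensor a b) c) = iR a * i0 b * iL c.
  by rewrite multE m1E.
exists mult; split=> //; exists P => [t|u].
- have [s ->] := tensor_span t; rewrite !linear_sum; apply: eq_bigr => -[c [t' d]] _.
  rewrite !linearZ /=; congr (_ *: _).
  (* The left factor lies in a tensor product itself and must also be expanded into pure tensors. *)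
  have [s' ->] := tensor_span t'.
  elim: s' => [|[e [a b]] s' IHs]; rewrite ?big_nil ?big_cons.
    by rewrite pure0l !linear0.
  rewrite pure_tensorDl pure_tensorZl [mult _]linearD [P _]linearD.
  rewrite [mult (_ *: _)]linearZ_LR.
  congr (_ + _); last exact: IHs.
  by rewrite [LHS]linearZ_LR /= mE P_pure.
- move: u (spanU u); apply: span_ind => [|s u v uE vE|_ [a [b [c ->]]]].
  + by rewrite !linear0.
  + by rewrite !linearP uE vE.
  + by rewrite PE mE.
Qed.

End MultiplicationIso.

(** * Words in free algebras and in generated subalgebras *)

Lemma malgUM (K : fieldType) (M : monomType) (a b : M) :
  (<< a >> : {malg K[M]}) * << b >> = << mmul a b >>.
Proof.
rewrite (malgMEw (d1 := [fset a]%fset) (d2 := [fset b]%fset)) ?msuppU_le //.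
by rewrite !big_seq_fset1 !mcoeffUU mulr1.
Qed.

Lemma free_alg_word (K : fieldType) (I : choiceType) (w : {fmonom I}) :
  (<< w >> : free_alg K I) = \prod_(i <- (w : seq I)) free_gen K i.
Proof.
case: w => w /=; elim: w => [|i w IHw].
  by rewrite big_nil -fmoneE.
rewrite big_cons -IHw.
have -> : FMonom (i :: w) = mmul (fmu i) (FMonom w) by rewrite [RHS]fmmulE fmuE.
by rewrite -malgUM.
Qed.

Lemma alg_eval_unique (K : fieldType) (I : choiceType) (A : algType K)
  (f : {lrmorphism free_alg K I -> A}) x :
  f x = alg_eval (f \o free_gen K (I := I)) x.
Proof.
move: x; apply: free_alg_ind => [|a x y xE yE|w]; first by rewrite !linear0.
  by rewrite [LHS]linearP [RHS]linearP /= xE yE.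
by rewrite alg_eval_word free_alg_word rmorph_prod.
Qed.

Lemma alg_eval_span (K : fieldType) (A : algType K) (h : 'I_2 -> A) x :
  alg_eval h x \in Defs.span (fun y => exists w : seq 'I_2, y = \prod_(j <- w) h j).
Proof.
move: x; apply: free_alg_ind => [|a x y xS yS|w].
- by rewrite linear0 span0.
- by rewrite linearP spanD // spanZ.
- by rewrite alg_eval_word; apply: mem_span; exists w.
Qed.

Lemma subalg_sub (K : fieldType) (A : algType K) (S T : A -> Prop) :
  (forall x, S x -> x \in subalg T) -> forall x, x \in subalg S -> x \in subalg T.
Proof. by move=> ST x /subalgP; apply=> //; apply: subalg_subalg_closed. Qed.

Section SubalgWords.
Variables (K : fieldType) (A : algType K) (S : A -> Prop) (h : 'I_2 -> A).
Hypothesis Sh : forall j, S (h j).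
Hypothesis S_h : forall x, S x -> x \in subalg (fun y => exists j, y = h j).

(** The inclusion, under a name that carries the structure of an algebra morphism. *)
Definition subalg_val (x : subalg_of S) : A := \val x.
Lemma subalg_val_zmod : zmod_morphism subalg_val. Proof. by []. Qed.
Lemma subalg_val_monoid : monoid_morphism subalg_val. Proof. by []. Qed.
Lemma subalg_val_scalable : scalable subalg_val. Proof. by []. Qed.
HB.instance Definition _ := GRing.isZmodMorphism.Build (subalg_of S) A
  subalg_val subalg_val_zmod.
HB.instance Definition _ := GRing.isMonoidMorphism.Build (subalg_of S) A
  subalg_val subalg_val_monoid.
HB.instance Definition _ := GRing.isScalable.Build K (subalg_of S) A *:%R
  subalg_val subalg_val_scalable.

Definition subalg_gen (j : 'I_2) : subalg_of S := Sub (h j) (mem_subalg (Sh j)).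

(** The element is a polynomial in the [h j]. The same polynomial evaluated inside the subalgebra
    has the same image, hence equals it. *)
Lemma subalg_gen_span a : a \in Defs.span
  (fun x => exists w : seq 'I_2, x = \prod_(j <- w) subalg_gen j).
Proof.
have [x ax] := subalg_alg_eval (subalg_sub S_h (valP a)).
suff -> : a = alg_eval subalg_gen x by apply: alg_eval_span.
apply: val_inj; rewrite [LHS]ax.
exact: (esym (alg_eval_morph subalg_val subalg_gen x)).
Qed.

Lemma val_subalg_word (w : seq 'I_2) :
  \val (\prod_(j <- w) subalg_gen j) = \prod_(j <- w) h j.
Proof. exact: (rmorph_prod subalg_val). Qed.

Lemma serre_subalg_gen q i j : serre q (h i) (h j) = 0 ->
  serre q (subalg_gen i) (subalg_gen j) = 0.
Proof.
move=> s0; apply: val_inj; rewrite [RHS](rmorph0 subalg_val).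
rewrite -s0; exact: (rmorph_serre q subalg_val).
Qed.

End SubalgWords.

(** * The triangular decomposition in terms of alternating generators *)

Section Decomposition.
Variables (K : fieldType) (q : K) (qbar : {rmorphism K -> K}).
Hypotheses (q0 : q != 0) (q1 : q + q^-1 != 0) (qbar_q : qbar q = q^-1).
Local Notation U := (Uq q).
Local Notation X := (Uq_gen q).

Let X_rel : skew_rel q X := DJ_rel_skew q0 (@Uq_relE K q).

Lemma Uq_triangular u : u \in triangular X.
Proof.
elim/Uq_ind: u => x; rewrite (alg_eval_unique (Uq_pi q)).
exact: (triangular_alg_eval _ q0 X_rel).
Qed.

Lemma Kpow_mem t : Kpow X t \in subalg (@Cartan_gen K q).
Proof.
by apply: rpredM; rewrite /Kz; [case: t.1 | case: t.2] => n; apply: rpredX;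
  apply: mem_subalg; eexists; [left | right | left | right].
Qed.

Definition U_zero_Kpow t : U_zero q := Sub (Kpow X t) (Kpow_mem t).

(** The span of the K^t contains 1 and is closed under products by [KpowD]. It contains [K_i] and
    its inverse as K^t for t = [unit_wt i] and its opposite. *)
Lemma U_zero_span k : k \in Defs.span (fun x => exists t, x = U_zero_Kpow t).
Proof.
pose S := Defs.span (fun x => exists t, x = U_zero_Kpow t).
have SK t : U_zero_Kpow t \in S by apply: mem_span; exists t.
have SM x y : x \in S -> y \in S -> x * y \in S.
  move=> + yS; move: x; apply: span_ind => [|a u v uS vS|_ [t ->]].
  - by rewrite mul0r; apply: span0.
  - by rewrite mulrDl -scalerAl; apply: spanD => //; apply: spanZ.
  move: y yS; apply: span_ind => [|a u v uS vS|_ [t' ->]].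
  - by rewrite mulr0; apply: span0.
  - by rewrite mulrDr -scalerAr; apply: spanD => //; apply: spanZ.
  have -> : U_zero_Kpow t * U_zero_Kpow t' = U_zero_Kpow (t + t').
    by apply: val_inj; apply: (KpowD q0 X_rel).
  exact: SK.
have S1 : 1 \in S.
  have <- : U_zero_Kpow 0 = 1 by apply: val_inj; apply: Kpow0.
  exact: SK.
(* Membership in [subalg] is tested by predicates on the ambient algebra, so the span is carried
   there along [\val]. *)
pose T : {pred U} := fun u => `[< exists2 k', k' \in S & u = \val k' >].
have TP u : reflect (exists2 k', k' \in S & u = \val k') (u \in T) by apply: asboolP.
suff /TP [k' k'S /val_inj ->] : \val k \in T by [].
move: (valP k) => /subalgP; apply.
- split=> [|a u v|u v].
  + by apply/TP; exists 1.
  + move=> /TP [x xS ->] /TP [y yS ->]; apply/TP; exists (a *: x + y) => //.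
    by apply: spanD => //; apply: spanZ.
  + move=> /TP [x xS ->] /TP [y yS ->]; apply/TP; exists (x * y) => //.
    exact: SM.
move=> _ [i [->|->]]; apply/TP.
- exists (U_zero_Kpow (unit_wt i)); first exact: SK.
  by rewrite /= -[unit_wt i]addr0 -(K_Kpow q0 X_rel) Kpow0 mulr1.
- exists (U_zero_Kpow (- unit_wt i)); first exact: SK.
  by rewrite /= -[- unit_wt i]addr0 -(KV_Kpow q0 X_rel) Kpow0 mulr1.
Qed.

Lemma Uq_triangular_decomposition :
  exists mult : {linear tensor (tensor (A_right q) (U_zero q)) (A_left q qbar) -> U},
    bijective mult /\
    forall (a : A_right q) (k : U_zero q) (b : A_left q qbar),
      mult (pure_tensor (pure_tensor a k) b) = \val a * \val k * \val b.
Proof.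
pose hE j : U := X (GenE j); pose hF j : U := X (GenF j).
have ShE j : right_alternating (hE j) := E_gen_right q1 j.
have ShF j : left_alternating qbar (hF j) := F_gen_left q0 q1 qbar_q j.
have SE x : right_alternating x -> x \in subalg (fun y => exists j, y = hE j).
  exact: right_alternating_E.
have SF x : left_alternating qbar x -> x \in subalg (fun y => exists j, y = hF j).
  exact: left_alternating_F.
pose rE := subalg_gen ShE; pose lF := subalg_gen ShF.
pose W := tensor (tensor (A_right q) (U_zero q)) (A_left q qbar).
(* With values in the tensor product itself, the functional obtained from [g] is the inverse of
   multiplication. *)
pose g (a : A_right q) t (b : A_left q qbar) : W :=
  pure_tensor (pure_tensor a (U_zero_Kpow t)) b.
have g_linl t b : linear (fun a => g a t b).
  by move=> c u v; rewrite /g !(pure_tensorDl, pure_tensorZl).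
have g_linr a t : linear (g a t).
  by move=> c u v; rewrite /g pure_tensorDr pure_tensorZr.
have serreR i j : i != j -> serre q (rE i) (rE j) = 0.
  by move=> ij; apply: serre_subalg_gen; apply: (Uq_relE (rel_serreE q X ij)).
have serreL i j : i != j -> serre q (lF i) (lF j) = 0.
  by move=> ij; apply: serre_subalg_gen; apply: (Uq_relE (rel_serreF q X ij)).
have [P PE] := Uq_functional q0 serreR serreL g_linl g_linr.
have rEv w : subalg_val (\prod_(j <- w) rE j) = Ew X w.
  exact: val_subalg_word.
have lFv y : subalg_val (\prod_(j <- y) lF j) = Fw X y.
  exact: val_subalg_word.
apply: (@multiplication_iso K U (A_right q) (U_zero q) (A_left q qbar)
  (@subalg_val _ _ _) (@subalg_val _ _ _) (@subalg_val _ _ _)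
  _ _ _ (fun w => \prod_(j <- w) rE j) U_zero_Kpow (fun y => \prod_(j <- y) lF j) P).
- exact: (subalg_gen_span ShE SE).
- exact: U_zero_span.
- exact: (subalg_gen_span ShF SF).
- move=> u; move: u (Uq_triangular u); apply: span_ind => [|a x y xS yS|_ [w [t [y ->]]]].
  + exact: span0.
  + by apply: spanD => //; apply: spanZ.
  + by apply: mem_span; exists w, t, y; rewrite -rEv -lFv.
- by move=> w t y; have := PE w t y; rewrite -rEv -lFv.
Qed.

End Decomposition.

Theorem mainTheorem9 (R : realType) :
  let C : fieldType := R[i] in
  let q : ratfun C := qvar C in
  exists mult : {linear tensor (tensor (A_right q) (U_zero q))
                               (A_left q (@qbar C)) -> Uq q},
    bijective mult /\
    forall (a : A_right q) (k : U_zero q) (b : A_left q (@qbar C)),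
      mult (pure_tensor (pure_tensor a k) b) = \val a * \val k * \val b.
Proof.
move=> C q; apply: Uq_triangular_decomposition.
- exact: qvar_neq0.
(* For n = 1 the powers reduce to [q] and its inverse by computation. *)
- exact: (qvar_add_neq0 C (n := 1)).
- exact: qbar_qvar.
Qed.
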